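(* For all integers $n>d\ge 2$, the cyclic polytope $C_d(n)$ satisfies Perles' conjecture. That is, the vertex stars are the only pure $(d-1)$-dimensional, dually connected, non-separating subcomplexes of the boundary complex of $C_d(n)$ for which every maximal simplex has exactly one free face.
   Context: The cyclic polytope $C_d(n)$ is the convex hull of $n$ distinct points on the moment curve $t\mapsto(t,t^2,\dots,t^d)$ in $\mathbb{R}^d$. It is a simplicial $d$-polytope whose combinatorial type depends only on $d$ and $n$. A simplicial $d$-polytope is said to satisfy Perles' conjecture if the vertex stars are the only pure $(d-1)$-dimensional, dually connected, non-separating subcomplexes of its boundary complex for which every maximal simplex has exactly one free face. The terms are as follows. A subcomplex $\Gamma$ is pure $(d-1)$-dimensional if it is nonempty and all its maximal simplices have dimension $d-1$. It is dually connected if any two of its $(d-1)$-simplices can be joined by a sequence of $(d-1)$-simplices of $\Gamma$ in which consecutive ones share a common $(d-2)$-face. It is non-separating if its complement in the boundary of the polytope is connected. A simplex of $\Gamma$ is free if it is contained in exactly one other (larger) face of $\Gamma$; thus the free faces in question are the $(d-2)$-simplices contained in exactly one $(d-1)$-simplex of $\Gamma$. The vertex star of a vertex $v$ is the subcomplex generated by all facets of the polytope that contain $v$. Equivalently, in terms of the polar dual simple polytope $P$ with graph $G(P)$ (vertices and edges of $P$): every induced, connected, $(d-1)$-regular, non-separating subgraph of $G(P)$ is the graph of a facet of $P$, where a subgraph is non-separating if deleting its vertices from $G(P)$ leaves a connected graph. *)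

(* Defs.v *)
From HB Require Import structures.
From mathcomp Require Import all_boot all_order all_algebra.
From mathcomp Require Import all_classical all_reals all_analysis.
Import Order.TTheory GRing.Theory Num.Theory.
Import numFieldNormedType.Exports.

Set Implicit Arguments.
Unset Strict Implicit.
Unset Printing Implicit Defensive.

Local Open Scope classical_set_scope.
Local Open Scope ring_scope.

Definition conv_hull (R : realType) (d n : nat) (x : 'I_n -> 'rV[R]_d)
    (S : {set 'I_n}) : set 'rV[R]_d :=
  [set y | exists a : 'I_n -> R,
     [/\ forall i, 0 <= a i,
         \sum_(i in S) a i = 1
       & y = \sum_(i in S) a i *: x i]].

(* Faces are cut out by valid linear inequalities c . y <= b; the empty set is
   a proper face, and c = 0, b = 0 gives the improper face P itself. *)
Definition polytope_face (R : realType) (d : nat) (P F : set 'rV[R]_d) : Prop :=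
  exists (c : 'cV[R]_d) (b : R),
    (forall y, P y -> (y *m c) 0 0 <= b) /\
    F = P `&` [set y | (y *m c) 0 0 = b].

Definition proper_face (R : realType) (d : nat) (P F : set 'rV[R]_d) : Prop :=
  polytope_face P F /\ F <> P.

(* The boundary complex of the polytope spanned by the points x i, each face
   being recorded by its vertex set.  This is meant for the x i being the
   vertices, without repetition, of a simplicial polytope.  The empty simplex is
   included, so a simplex s has dimension #|s| - 1. *)
Definition boundary_complex (R : realType) (d n : nat)
    (x : 'I_n -> 'rV[R]_d) : {set {set 'I_n}} :=
  [set s : {set 'I_n} |
     `[< proper_face (conv_hull x [set: 'I_n]%SET) (conv_hull x s) >]]%SET.

Definition realization (R : realType) (d n : nat) (x : 'I_n -> 'rV[R]_d)
    (G : {set {set 'I_n}}) : set 'rV[R]_d :=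
  \bigcup_(s in [set` G]) conv_hull x s.

Definition subcomplex (T : finType) (G K : {set {set T}}) : Prop :=
  G \subset K /\ (forall s t : {set T}, s \in G -> t \subset s -> t \in G).

Definition maximal_simplex (T : finType) (G : {set {set T}}) (s : {set T}) :=
  maxset [pred t : {set T} | t \in G] s.

(* The complex is pure of dimension d - 1. *)
Definition pure_codim1 (T : finType) (d : nat) (G : {set {set T}}) : Prop :=
  G != finset.set0 /\ (forall s, maximal_simplex G s -> #|s| = d).

Definition dual_adj (T : finType) (d : nat) (G : {set {set T}}) : rel {set T} :=
  fun s t => [&& s \in G, t \in G, #|s| == d, #|t| == d &
    [exists r : {set T}, [&& #|r| == d.-1, r \subset s & r \subset t]]].

Definition dually_connected (T : finType) (d : nat) (G : {set {set T}}) : Prop :=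
  forall s t : {set T}, s \in G -> t \in G -> #|s| = d -> #|t| = d ->
    connect (dual_adj d G) s t.

(* The boundary of a polytope is the union of its proper faces. *)
Definition non_separating (R : realType) (d n : nat) (x : 'I_n -> 'rV[R]_d)
    (G : {set {set 'I_n}}) : Prop :=
  connected (realization x (boundary_complex x) `\` realization x G).

Definition free_simplex (T : finType) (G : {set {set T}}) (s : {set T}) : bool :=
  (s \in G) && (#|[set t in G | s \proper t]%SET| == 1%N).

Definition one_free_face (T : finType) (G : {set {set T}}) : Prop :=
  forall s, maximal_simplex G s ->
    #|[set r : {set T} | free_simplex G r && (r \subset s)]%SET| = 1%N.

Definition vertex_star (T : finType) (K : {set {set T}}) (v : T) :
    {set {set T}} :=
  [set s : {set T} | [exists F : {set T},
     [&& maximal_simplex K F, v \in F & s \subset F]]]%SET.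

Definition satisfies_perles (R : realType) (d n : nat)
    (x : 'I_n -> 'rV[R]_d) : Prop :=
  forall G : {set {set 'I_n}},
    subcomplex G (boundary_complex x) ->
    pure_codim1 d G ->
    dually_connected d G ->
    non_separating x G ->
    one_free_face G ->
    exists v : 'I_n, G = vertex_star (boundary_complex x) v.

Definition moment_curve (R : realType) (d : nat) (t : R) : 'rV[R]_d :=
  \row_(j < d) t ^+ j.+1.

Definition cyclic_polytope_vertices (R : realType) (d n : nat)
    (t : 'I_n -> R) : 'I_n -> 'rV[R]_d :=
  fun i => moment_curve d (t i).

(* Main.v *)
Require Import Defs.
From mathcomp Require Import all_boot zify.

Set Implicit Arguments.
Unset Strict Implicit.
Unset Printing Implicit Defensive.

(** Call a facet of the cyclic polytope outside when it is not in the complex G.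
    The theorem rests on one combinatorial fact: some vertex v lies on no outside
    facet.  Granting it, every facet through v is in G.  The free ridge of such a
    facet F is shared with an outside facet, which avoids v, so this ridge is
    F minus v; all the other neighbours of F in G therefore contain v, and since G
    is dually connected, all its facets contain v: G is the star of v
    ([complex_star]).

    Three properties of the set Y of outside facets are used.  A facet of G has
    exactly one ridge in common with outside facets, and a ridge lies in at most
    two facets, so a facet with two distinct neighbours in Y is itself in Y
    ([outside_closed]; such a Y is called two_closed).  Since G does not separate,
    Y is connected by ridges ([outside_connected]).  Finally some facet of G has a
    neighbour in Y.

    To find v ([gale_avoid]), facets are described by Gale's evenness condition:
    along the curve, the number of vertices of F below a vertex missing from F has
    constant parity.  Suppose first that d is even.  Then the condition is invariant
    under rotations and reflections of the cyclic order.  Take F0 in G next to G0 in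
    Y, let v be in F0 but not in G0, and turn the cycle so that v comes first
    and the second vertex is in G0.  The facets that avoid v are the disjoint
    unions of pairs of consecutive vertices, and their first pair can be slid down
    freely.  Write G[t] for G with its first pair slid to position t, so that G[0]
    contains v.  At G0 the facet G0[1] = G0 is in Y and G0[0] is not.  Along
    a path in Y this persists ([inactive_step]): if G and G' are neighbours, then
    G'[t] is a neighbour of (or equal to) G[t] and of G'[t+1], so it is in Y by
    induction on decreasing t; and if G'[0] were in Y, then G[0] would have the two
    neighbours G'[0] and G[1] in Y.  The path never reaches a facet G' containing v
    ([inactive_avoid]): if G contains the second vertex, G[0] is next to
    both G and G'; otherwise G contains the last vertex, its last pair can be pushed
    over v, within Y, and sliding the first pair down afterwards produces a facet
    of Y next to G[0], which is also next to G[1].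

    If d is odd, every facet contains the first or the last vertex of the curve,
    and a facet avoiding one of them can trade the other one for it.  If some F
    in G is separated from a neighbour in Y by losing the first (or last) vertex,
    this trade is a rigid substitute for sliding, and Y avoids that vertex
    ([exchange_avoid]).  Otherwise Y is stable under the trade; contracting the
    edge between the two end vertices then turns Y into a set of facets of an
    even-dimensional cyclic polytope with one vertex less, to which the even case
    applies ([odd_avoid]).

    Geometry enters through polynomials.  Affine functionals on the moment curve are
    the polynomials of degree at most d in the parameter, so a set of vertices is a
    proper face when it is the zero set, on the parameters, of a nonnegative
    polynomial of degree at most d ([boundary_supports]), and counting signs of
    products of linear factors gives Gale's condition ([boundary_gale]).  On the
    complement of the realization of G, the union of the facets in one class of
    Y is cut out by finitely many supporting hyperplanes, so a partition of Y into
    two classes without common ridges would disconnect this complement; that two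
    facets meeting outside G are in the same class holds because the facets through
    a given face are connected by ridges ([link_connected]). *)

(** * Gale's evenness condition and pivots *)

Section GaleSets.
Variables (T : finType) (pos : T -> nat).
Hypothesis pos_inj : injective pos.
Implicit Types (F G s : {set T}) (u v w x y : T).

Definition below F x := #|[set u in F | pos u < pos x]|.

(** Gale's evenness condition on the ground set of the vertices at positions below N:
    between two missing vertices there is an even number of elements of F, that is,
    the parity of [below F] does not depend on the missing vertex. *)
Definition gale N d F :=
  [&& #|F| == d, [forall x in F, pos x < N] &
   [forall x, forall y,
     [&& pos x < N, pos y < N, x \notin F & y \notin F] ==>
       (odd (below F x) == odd (below F y))]].

Lemma galeP N d F :
  reflect [/\ #|F| = d, forall x, x \in F -> pos x < N
    & exists b, forall x, pos x < N -> x \notin F -> odd (below F x) = b]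
    (gale N d F).
Proof.
apply: (iffP and3P) => [[/eqP cF /forall_inP FN /forallP par]|[cF FN [b par]]].
  split=> //; case: (pickP [pred x | (pos x < N) && (x \notin F)]) => [y|no_hole].
    case/andP=> yN yF; exists (odd (below F y)) => x xN xF.
    by have /forallP/(_ y)/implyP/(_ _)/eqP := par x; apply; apply/and4P.
  by exists true => x xN xF; have := no_hole x; rewrite /= xN xF.
split; first exact/eqP.
  exact/forall_inP.
apply/forallP=> x; apply/forallP=> y; apply/implyP=> /and4P[xN yN xF yF].
by rewrite (par x) // (par y).
Qed.

Lemma below_setU1 w F x :
  w \notin F -> below (w |: F) x = (pos w < pos x) + below F x.
Proof.
move=> wF; rewrite /below.
have -> : [set u in w |: F | pos u < pos x] =
    (if pos w < pos x then [set w] else set0) :|: [set u in F | pos u < pos x].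
  apply/setP=> u; rewrite !inE; case: (eqVneq u w) => [->|uw] /=.
    by case: ifP => wx; rewrite !inE ?eqxx ?wx /= ?(negPf wF).
  by case: ifP; rewrite !inE ?(negPf uw).
case: ifP => _; last by rewrite set0U.
by rewrite cardsU1 inE (negPf wF).
Qed.

Lemma below_setD1 u F x :
  u \in F -> below F x = (pos u < pos x) + below (F :\ u) x.
Proof.
by move=> uF; rewrite -{1}(setD1K uF) below_setU1 // !inE eqxx.
Qed.

Lemma odd_below_swap u w F x : u \in F -> w \notin F ->
  odd (below (w |: F :\ u) x) =
    odd (below F x) (+) (pos u < pos x) (+) (pos w < pos x).
Proof.
move=> uF wF; rewrite (below_setD1 x uF) below_setU1; last by rewrite !inE (negPf wF) andbF.
by rewrite !oddD !oddb; case: (odd _); case: (_ < _); case: (_ < _).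
Qed.

Lemma card_swap u w F : u \in F -> w \notin F -> #|w |: F :\ u| = #|F|.
Proof.
move=> uF wF; rewrite cardsU1 !inE (negPf wF) andbF /= (cardsD1 u F) uF; lia.
Qed.

Lemma gale_swap N d F u w b :
    gale N d F -> u \in F -> w \notin F -> pos w < N ->
    (forall x, pos x < N -> x != w -> x \notin F :\ u ->
      odd (below F x) (+) (pos u < pos x) (+) (pos w < pos x) = b) ->
  gale N d (w |: F :\ u).
Proof.
case/galeP=> cF FN _ uF wF wN par; apply/galeP; split.
- by rewrite card_swap.
- by move=> x; rewrite !inE => /orP[/eqP-> // | /andP[_ /FN]].
exists b => x xN; rewrite odd_below_swap // in_setU1 negb_or => /andP[xw xF].
exact: par.
Qed.

(** Adding a, b or c to C changes the parity of [below] only above the added vertex;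
    the three resulting conditions on the three pairs contradict each other. *)
Lemma gale_thin N d (C : {set T}) a b c :
    a \notin C -> b \notin C -> c \notin C -> a != b -> a != c -> b != c ->
  gale N d (a |: C) -> gale N d (b |: C) -> gale N d (c |: C) -> False.
Proof.
move=> aC bC cC ab ac bc /galeP[_ aN [p1 P1]] /galeP[_ bN [p2 P2]] /galeP[_ cN [p3 P3]].
have {}aN : pos a < N by apply: aN; rewrite setU11.
have {}bN : pos b < N by apply: bN; rewrite setU11.
have {}cN : pos c < N by apply: cN; rewrite setU11.
have out x y : x \notin C -> x != y -> x \notin y |: C.
  by move=> xC xy; rewrite in_setU1 negb_or xy.
have Eab : odd (below (a |: C) b) = odd (below (a |: C) c).
  by rewrite (P1 b) ?(P1 c) // out // eq_sym.
have Eba : odd (below (b |: C) a) = odd (below (b |: C) c).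
  by rewrite (P2 a) ?(P2 c) // out // eq_sym.
have Eca : odd (below (c |: C) a) = odd (below (c |: C) b).
  by rewrite (P3 a) ?(P3 b) // out // eq_sym.
move: Eab Eba Eca; rewrite !below_setU1 // !oddD !oddb.
have pab : pos a != pos b by apply: contra_neq ab => /pos_inj.
have pac : pos a != pos c by apply: contra_neq ac => /pos_inj.
have pbc : pos b != pos c by apply: contra_neq bc => /pos_inj.
case: (ltngtP (pos a) (pos b)) pab => // _ _;
case: (ltngtP (pos a) (pos c)) pac => // _ _;
case: (ltngtP (pos b) (pos c)) pbc => // _ _ /=;
by do 3 case: (odd _).
Qed.

(** If the parity at u differs from that of the holes, u moves to the nearest hole
    below it.  If it agrees but no hole lies above u, then u moves, through the
    end of the order, to the lowest hole. *)
Lemma gale_pivot_left N d F u x b :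
    gale N d F -> u \in F ->
    (forall y, pos y < N -> y \notin F -> odd (below F y) = b) ->
    x \notin F -> pos x < pos u ->
    (odd (below F u) != b) || [forall y, (pos u < pos y < N) ==> (y \in F)] ->
  exists w, [/\ w \notin F, pos w < pos u & gale N d (w |: F :\ u)].
Proof.
move=> gF uF par xF xu; have /galeP[_ FN _] := gF; have uN := FN _ uF.
pose hole w := (w \notin F) && (pos w < pos u).
have hx : hole x by apply/andP.
case: (boolP (odd (below F u) != b)) => /= [ub _|/negPn/eqP ub /forallP above].
  have [w /andP[wF wu] wmax] := arg_maxnP pos hx.
  exists w; split=> //; have wN := ltn_trans wu uN.
  apply: (gale_swap (b := b)) => // y yN yw.
  rewrite !inE negb_and negbK => yFu.
  have pyw : pos y != pos w by apply: contra_neq yw => /pos_inj.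
  case: (eqVneq y u) yFu => [-> _|yu /= yF].
    by rewrite ltnn wu; case: (odd _) (b) ub => [] [].
  have pyu : pos y != pos u by apply: contra_neq yu => /pos_inj.
  rewrite par //; case: (ltngtP (pos y) (pos w)) pyw => // yw' _.
    by rewrite ltnNge ltnW ?(ltn_trans yw') // addbF addbF.
  case: (ltngtP (pos y) (pos u)) pyu => // yu' _; last by rewrite !addbT negbK.
  have hy : hole y by apply/andP.
  have := wmax y hy => /=; lia.
have [w /andP[wF wu] wmin] := arg_minnP pos hx.
exists w; split=> //; have wN := ltn_trans wu uN.
apply: (gale_swap (b := ~~ b)) => // y yN yw.
rewrite !inE negb_and negbK => yFu.
have pyw : pos y != pos w by apply: contra_neq yw => /pos_inj.
case: (eqVneq y u) yFu => [-> _|yu /= yF]; first by rewrite ltnn wu ub addbF addbT.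
have pyu : pos y != pos u by apply: contra_neq yu => /pos_inj.
have yu' : pos y < pos u.
  rewrite ltnNge leq_eqVlt eq_sym (negPf pyu) /=; apply: contra yF => uy.
  by have /implyP := above y; apply; rewrite uy.
have hy : hole y by apply/andP.
have wy := wmin y hy.
rewrite par // ltnNge (ltnW yu') /= addbF ltn_neqAle eq_sym pyw wy; exact: addbT.
Qed.

End GaleSets.

Section GaleMoves.
Variables (T : finType) (pos : T -> nat).
Hypothesis pos_inj : injective pos.
Implicit Types (F G s : {set T}) (u v w x y : T).
Local Notation below := (below pos).
Local Notation gale := (gale pos).

Lemma gale_pivot_right N d F u x b :
    gale N d F -> u \in F ->
    (forall y, pos y < N -> y \notin F -> odd (below F y) = b) ->
    x \notin F -> pos u < pos x < N ->
    (odd (below F u) == b) || [forall y, (pos y < pos u) ==> (y \in F)] ->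
  exists2 w, w \notin F & gale N d (w |: F :\ u).
Proof.
move=> gF uF par xF ux; have /galeP[_ FN _] := gF; have uN := FN _ uF.
pose hole w := (w \notin F) && (pos u < pos w < N).
have hx : hole x by apply/andP.
case: (boolP (odd (below F u) == b)) => /= [/eqP ub _|ub /forallP low].
  have [w /and3P[wF uw wN] wmin] := arg_minnP pos hx.
  exists w => //; apply: (gale_swap (b := b)) => // y yN yw.
  rewrite !inE negb_and negbK => yFu.
  have pyw : pos y != pos w by apply: contra_neq yw => /pos_inj.
  case: (eqVneq y u) yFu => [-> _|yu /= yF].
    by rewrite ltnn ub addbF ltnNge ltnW //= addbF.
  have pyu : pos y != pos u by apply: contra_neq yu => /pos_inj.
  rewrite par //; case: (ltngtP (pos y) (pos u)) pyu => // yu' _.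
    by rewrite ltnNge ltnW ?(ltn_trans yu') // addbF addbF.
  case: (ltngtP (pos y) (pos w)) pyw => // yw' _; last by rewrite !addbT negbK.
  have hy : hole y by apply/and3P.
  have := wmin y hy => /=; lia.
have [w /and3P[wF uw wN] wmax] := arg_maxnP pos hx.
exists w => //; apply: (gale_swap (b := ~~ b)) => // y yN yw.
rewrite !inE negb_and negbK => yFu.
have pyw : pos y != pos w by apply: contra_neq yw => /pos_inj.
case: (eqVneq y u) yFu => [-> _|yu /= yF].
  by rewrite ltnn ltnNge (ltnW uw) /= !addbF; case: (odd _) (b) ub => [] [].
have pyu : pos y != pos u by apply: contra_neq yu => /pos_inj.
have uy : pos u < pos y.
  rewrite ltnNge leq_eqVlt (negPf pyu) /=; apply: contra yF => yu'.
  by have /implyP := low y; apply.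
have hy : hole y by apply/and3P.
have wy : pos y <= pos w := wmax y hy.
rewrite par // uy addbT ltnNge /= wy addbF //.
Qed.

Lemma below_nil F x : (forall y, pos y < pos x -> y \notin F) -> below F x = 0.
Proof.
move=> low; apply/eqP; rewrite cards_eq0 -subset0; apply/subsetP=> y.
by rewrite !inE => /andP[yF /low]; rewrite yF.
Qed.

Lemma below_full F x : (forall y, y \in F -> pos y < pos x) -> below F x = #|F|.
Proof.
move=> low; congr #|pred_of_set _|; apply/setP=> y; rewrite !inE.
by apply: andb_idr => /low.
Qed.

Lemma below_split F x y : pos x <= pos y ->
  below F y = below F x + #|[set z in F | pos x <= pos z < pos y]|.
Proof.
move=> xy; rewrite /below.
rewrite -(cardsID [set z | pos z < pos x] [set u in F | pos u < pos y]).
by congr addn; apply: eq_card => z; rewrite !inE; lia.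
Qed.

(** For facets F and G of the same size: F = G, or F and G share a ridge.  Admitting
    equality saves case distinctions when moves are composed. *)
Definition near F G := #|F :\: G| <= 1.

Definition near_in (Y : pred {set T}) F G := [&& Y F, Y G & near F G].

Definition two_closed N d (Y : pred {set T}) := forall F G1 G2, gale N d F ->
  Y G1 -> Y G2 -> G1 != G2 -> near F G1 -> near F G2 -> Y F.

Lemma near_sub u F G : F \subset u |: G -> near F G.
Proof.
move=> FG; rewrite /near -(cards1 u); apply: subset_leq_card.
by apply/subsetP=> x; rewrite !inE => /andP[xG /(subsetP FG)]; rewrite !inE (negPf xG) orbF.
Qed.

Lemma near_sym F G : #|F| = #|G| -> near F G = near G F.
Proof. by rewrite /near !cardsD setIC => ->. Qed.

Lemma near_uniq F G u w : near F G -> u \in F -> u \notin G -> w \in F -> w \notin G -> u = w.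
Proof.
move=> /card_le1_eqP FG uF uG wF wG.
by apply: (FG w u); rewrite inE ?uF ?uG ?wF ?wG.
Qed.

Lemma near_mem F G v u : near F G -> v \in F -> v \notin G -> u \in F -> u != v -> u \in G.
Proof.
move=> nFG vF vG uF uv; apply: contraNT uv => uG.
by apply/eqP; apply: near_uniq nFG _ _ _ _.
Qed.

Lemma near_swap F u w : u \in F -> near (w |: F :\ u) F.
Proof.
by move=> uF; apply: (near_sub (u := w)); apply: setUS; apply: subD1set.
Qed.

Lemma near_swap' F u w : near F (w |: F :\ u).
Proof.
apply: (near_sub (u := u)); apply/subsetP=> x; rewrite !inE => ->.
by case: eqP; rewrite /= ?orbT.
Qed.

Section Ground.
Variables (N : nat) (site : nat -> T).
Hypothesis siteK : forall k, k < N -> pos (site k) = k.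

Lemma posK x : pos x < N -> site (pos x) = x.
Proof. by move=> xN; apply: pos_inj; rewrite siteK. Qed.

Lemma site_eq k x : k < N -> (x == site k) = (pos x == k).
Proof.
move=> kN; apply/eqP/eqP=> [->|xk]; first exact: siteK.
by apply: pos_inj; rewrite siteK.
Qed.

Lemma card_ground : #|[set x | pos x < N]| = N.
Proof.
have -> : [set x | pos x < N] = [set site i | i : 'I_N].
  apply/setP=> x; rewrite inE; apply/idP/imsetP=> [xN|[i _ ->]]; last by rewrite siteK.
  by exists (Ordinal xN); rewrite //= posK.
rewrite card_imset ?card_ord // => i j ij; apply: val_inj.
by rewrite /= -(siteK (ltn_ord i)) ij siteK.
Qed.

Lemma gale_hole d F : gale N d F -> d < N -> exists2 x, pos x < N & x \notin F.
Proof.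
case/galeP=> cF _ _ dN.
case: (boolP ([set x | pos x < N] \subset F)) => [/subset_leq_card|].
  by rewrite card_ground cF leqNgt dN.
by case/subsetPn=> x; rewrite inE; exists x.
Qed.

(** Every ridge has a second facet: depending on the parity at u and on the holes
    available on either side, the pivot goes left or right. *)
Lemma gale_pivot d F u : gale N d F -> d < N -> u \in F ->
  exists2 w, w \notin F & gale N d (w |: F :\ u).
Proof.
move=> gF dN uF; have /galeP[_ FN [b par]] := gF.
have [x xN xF] := gale_hole gF dN.
have pxu : pos x != pos u by apply: contraNneq xF => /pos_inj ->.
pose low := [forall y, (pos y < pos u) ==> (y \in F)].
pose high := [forall y, (pos u < pos y < N) ==> (y \in F)].
have lowP : ~~ low -> exists2 y, y \notin F & pos y < pos u.
  by rewrite negb_forall => /existsP[y]; rewrite negb_imply => /andP[]; exists y.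
have highP : ~~ high -> exists2 y, y \notin F & pos u < pos y < N.
  by rewrite negb_forall => /existsP[y]; rewrite negb_imply => /andP[]; exists y.
have lowhigh : low -> high -> False.
  move=> /forallP/(_ x) /implyP lx /forallP/(_ x) /implyP hx.
  by move/negP: xF; apply; case: (ltngtP (pos x) (pos u)) pxu => // xu _;
    [apply: lx | apply: hx; rewrite xu].
have left y : y \notin F -> pos y < pos u -> (odd (below F u) != b) || high ->
    exists2 w, w \notin F & gale N d (w |: F :\ u).
  move=> yF yu c; have [w [wF _ gw]] := gale_pivot_left pos_inj gF uF par yF yu c.
  by exists w.
case: (eqVneq (odd (below F u)) b) => ub.
  case: (boolP high) => [hi|/highP[y yF yu]].
    have /lowP[y yF yu] : ~~ low by apply/negP=> /lowhigh/(_ hi).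
    by apply: left yF yu _; rewrite hi orbT.
  by apply: (gale_pivot_right gF uF par yF yu); rewrite ub eqxx.
case: (boolP low) => [lo|/lowP[y yF yu]]; last by apply: left yF yu _; rewrite ub.
have /highP[y yF yu] : ~~ high by apply/negP=> /(lowhigh lo).
by apply: (gale_pivot_right gF uF par yF yu); apply/orP; right.
Qed.

(** Facets containing s are compared by sliding their other vertices to the left.
    A facet is packed when no vertex outside s has a left pivot: such a vertex
    with a hole below it also has a hole above it, of the same parity as itself. *)
Definition packed s F :=
  [forall u in F :\: s, [exists x, (pos x < pos u) && (x \notin F)] ==>
    [exists y, [&& pos u < pos y, pos y < N, y \notin F & odd (below F u) == odd (below F y)]]].

Lemma packedP d s F b : gale N d F ->
    (forall y, pos y < N -> y \notin F -> odd (below F y) = b) -> packed s F ->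
  forall u x, u \in F -> u \notin s -> x \notin F -> pos x < pos u ->
    odd (below F u) = b /\ exists y, [/\ pos u < pos y, pos y < N & y \notin F].
Proof.
move=> gF par /forall_inP pk u x uF us xF xu.
have uFs : u \in F :\: s by rewrite inE us.
have /implyP := pk u uFs; case/(_ _)/existsP; first by apply/existsP; exists x; rewrite xu.
by move=> y /and4P[uy yN yF /eqP->]; rewrite par //; split=> //; exists y.
Qed.

(** A vertex outside s above the last hole would have a hole below and none above. *)
Lemma packed_last d s F b x : gale N d F -> 
    (forall y, pos y < N -> y \notin F -> odd (below F y) = b) -> packed s F ->
    s \subset F -> x \notin F -> pos x < N ->
  exists y, [/\ y \notin F, pos x <= pos y < N
    & forall z, pos y < pos z < N -> z \in s].
Proof.
move=> gF par pk sF xF xN.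
pose hole w := (w \notin F) && (pos x <= pos w < N).
have hx : hole x by rewrite /hole xF leqnn.
have [y /and3P[yF xy yN] ymax] := arg_maxnP pos hx.
exists y; split=> //; first by rewrite xy.
move=> z /andP[yz zN]; have above w : pos y < pos w < N -> w \in F.
  case/andP=> yw wN; apply: contraLR yw => wF; rewrite -leqNgt.
  case: (leqP (pos x) (pos w)) => [xw|/ltnW/leq_trans->//].
  by apply: ymax; rewrite /hole wF xw.
have zF : z \in F by apply: above; rewrite yz.
apply: contraTT isT => zs.
have [_ [w [zw wN]]] := packedP gF par pk zF zs yF yz.
by rewrite above // (ltn_trans yz).
Qed.

Lemma below_above F y : below F y + #|[set z in F | pos y <= pos z]| = #|F|.
Proof.
rewrite /below -(cardsID [set z | pos z < pos y] F).
by congr addn; apply: eq_card => z; rewrite !inE //; lia.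
Qed.

(** Both facets have the same last block, by [packed_last], hence the same parity of
    holes.  At a vertex u in F' but not in F the two counts differ by one from then
    on, so at each later vertex one of the two parities is wrong, which forces this
    vertex into s.  Then u has no hole of F' above it, although it lies outside s. *)
Lemma packed_unique d s F F' : gale N d F -> gale N d F' ->
  s \subset F -> s \subset F' -> packed s F -> packed s F' -> F = F'.
Proof.
move=> gF gF' sF sF' pF pF'; apply/eqP; apply: contraT => FF'.
have /galeP[cF FN [b par]] := gF; have /galeP[cF' FN' [b' par']] := gF'.
have [x xF xF'] : exists2 x, x \in F & x \notin F'.
  by apply/subsetPn; apply: contra FF' => FF'; rewrite eqEcard FF' cF cF' leqnn.
have [u uF' uF] : exists2 u, u \in F' & u \notin F.
  by apply/subsetPn; apply: contra FF' => F'F; rewrite eq_sym eqEcard F'F cF cF' leqnn.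
(* by symmetry, F' has a hole x below u *)
wlog xu : F F' b b' x u gF gF' sF sF' pF pF' {FF'} cF cF' FN FN' par par' xF xF' uF uF'
    / pos x < pos u.
  move=> W; case: (ltngtP (pos x) (pos u)); first by move=> xu; apply: (W F F' b b' x u).
    by move=> ux; apply: (W F' F b' b u x).
  by move/pos_inj=> xu; rewrite xu (negPf uF) in xF.
have uN := FN' _ uF'; have xN := FN _ xF.
have [y [yF /andP[_ yN] ys]] := packed_last gF par pF sF uF uN.
have [y' [yF' /andP[_ yN'] ys']] := packed_last gF' par' pF' sF' xF' xN.
have yy' : y = y'.
  apply: pos_inj; case: (ltngtP (pos y) (pos y')) => // lt_yy.
    by have := subsetP sF' y' (ys y' _); rewrite lt_yy yN' (negPf yF') => /(_ isT).
  by have := subsetP sF y (ys' y _); rewrite lt_yy yN (negPf yF) => /(_ isT).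
have eb : b = b'.
  rewrite -(par y) // -(par' y') // -yy'.
  suff -> : below F y = below F' y by [].
  apply/eqP; rewrite -(eqn_add2r #|[set z in F | pos y <= pos z]|) below_above cF -cF'.
  rewrite -(below_above F' y) eqn_add2l; apply/eqP; apply: eq_card => z; rewrite !inE.
  case: (ltngtP (pos y) (pos z)) => [yz||/pos_inj <-]; rewrite ?andbT ?andbF //.
    apply/idP/idP=> [/FN' zN|/FN zN].
      by apply: (subsetP sF); apply: ys; rewrite yz.
    by apply: (subsetP sF'); apply: ys; rewrite yz.
  by rewrite (negPf yF) yy' (negPf yF').
subst b'; have us : u \notin s by apply: contra uF => /(subsetP sF).
have [ub [w [uw wN wF']]] := packedP gF' par' pF' uF' us xF' xu.
(* the wrong parity propagates from u to the end of the order *)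
suff /(_ w) : forall z, pos u < pos z < N -> z \in s.
  by rewrite uw wN => /(_ isT)/(subsetP sF'); rewrite (negPf wF').
move=> z; have [k] := ubnP (pos z); elim: k z => // k IHk z zk /andP[uz zN].
pose M := [set v | pos u < pos v < pos z].
have Ms v : v \in M -> v \in s.
  rewrite inE => /andP[uv vz]; apply: IHk; first exact: leq_trans vz zk.
  by rewrite uv (ltn_trans vz).
have EF : odd (below F z) = b (+) odd #|M|.
  rewrite (below_split F (ltnW uz)) oddD par //; congr (_ (+) odd _).
  apply: eq_card => v; rewrite !inE; case: (eqVneq v u) => [->|vu].
    by rewrite (negPf uF) ltnn.
  have pvu : pos v != pos u by apply: contra_neq vu => /pos_inj.
  rewrite (ltn_neqAle (pos u)) eq_sym pvu /=; apply: andb_idl => uvz.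
  apply: (subsetP sF); apply: Ms; rewrite inE ltn_neqAle eq_sym pvu //.
have EF' : odd (below F' z) = ~~ (b (+) odd #|M|).
  rewrite (below_split F' (ltnW uz)) oddD ub.
  suff -> : #|[set v in F' | pos u <= pos v < pos z]| = #|u |: M|.
    by rewrite cardsU1 inE ltnn /= addbN.
  apply: eq_card => v; rewrite !inE; case: (eqVneq v u) => [->|vu].
    by rewrite uF' leqnn uz.
  have pvu : pos v != pos u by apply: contra_neq vu => /pos_inj.
  rewrite (ltn_neqAle (pos u)) eq_sym pvu /=; apply: andb_idl => uvz.
  apply: (subsetP sF'); apply: Ms; rewrite inE ltn_neqAle eq_sym pvu //.
case: (boolP (odd #|M|)) EF EF' => _; rewrite ?addbT ?addbF ?negbK => EF EF'.
  have zF : z \in F by apply: contraT => /(par z zN); rewrite EF; case: (b).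
  apply: contraT => zs; have [] := packedP gF par pF zF zs uF uz.
  by rewrite EF; case: (b).
have zF : z \in F' by apply: contraT => /(par' z zN); rewrite EF'; case: (b).
apply: contraT => zs; have [] := packedP gF' par' pF' zF zs xF' (ltn_trans xu uz).
by rewrite EF'; case: (b).
Qed.

Definition link_near d s F G :=
  [&& gale N d F, gale N d G, s \subset F, s \subset G & near F G].

Lemma link_near_sym d s : symmetric (link_near d s).
Proof.
move=> F G; rewrite /link_near.
case: (boolP (gale N d F)) => [/galeP[cF _ _]|]; last by rewrite andbF.
case: (boolP (gale N d G)) => [/galeP[cG _ _]|] //=.
by rewrite near_sym ?cF // andbCA.
Qed.

Lemma link_packed d s F : gale N d F -> s \subset F ->
  exists2 P, [/\ gale N d P, s \subset P & packed s P] & connect (link_near d s) F P.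
Proof.
have [k] := ubnP (\sum_(z in F) pos z); elim: k F => // k IHk F Fk gF sF.
case: (boolP (packed s F)) => [pF|]; first by exists F.
case/forall_inPn=> u; rewrite inE => /andP[us uF]; rewrite negb_imply.
case/andP=> /existsP[x /andP[xu xF]]; rewrite negb_exists => /forallP nohole.
have /galeP[_ FN [b par]] := gF.
have stuck : (odd (below F u) != b) || [forall y, (pos u < pos y < N) ==> (y \in F)].
  case: eqP => //= ub; apply/forallP=> y; apply/implyP=> /andP[uy yN].
  by have := nohole y; rewrite uy yN ub /=; apply: contraR => yF; rewrite yF (par y) //=.
have [w [wF wu gw]] := gale_pivot_left pos_inj gF uF par xF xu stuck.
have sw : s \subset w |: F :\ u.
  apply/subsetP=> z zs; rewrite !inE (subsetP sF) // andbT orbC.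
  by case: eqP us => // <-; rewrite zs.
have [|P gP FP] := IHk _ _ gw sw.
  rewrite big_setU1 /=; last by rewrite !inE (negPf wF) andbF.
  by move: Fk; rewrite (big_setD1 u uF) /=; lia.
exists P => //; apply: connect_trans FP; apply: connect1.
by rewrite /link_near gF gw sF sw near_swap'.
Qed.

(** Left pivots lead both facets to the unique packed one. *)
Lemma link_connected d s F F' : gale N d F -> gale N d F' ->
  s \subset F -> s \subset F' -> connect (link_near d s) F F'.
Proof.
move=> gF gF' sF sF'.
have [P [gP sP pP] FP] := link_packed gF sF.
have [P' [gP' sP' pP'] F'P'] := link_packed gF' sF'.
rewrite (packed_unique gP gP' sP sP' pP pP') in FP.
by apply: connect_trans FP _; rewrite (sym_connect_sym (@link_near_sym d s)).
Qed.

End Ground.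
End GaleMoves.

(** * Sliding pairs in even dimension *)

Section EvenCore.
Variables (T : finType) (pos : T -> nat).
Hypothesis pos_inj : injective pos.
Variables (N : nat) (site : nat -> T).
Hypothesis siteK : forall k, k < N -> pos (site k) = k.
Variables (m : nat) (Y : pred {set T}).
Hypothesis Ygale : forall F, Y F -> gale pos N m.*2 F.
Hypothesis Yclosed : two_closed pos N m.*2 Y.
Implicit Types (F G : {set T}) (a t : nat).

Local Notation below := (below pos).
Local Notation gale := (gale pos N m.*2).
Local Notation site_eq := (site_eq pos_inj siteK).

(** In a facet without the first vertex, consecutive pairs tile the facet; the lowest
    pair is at positions a and a + 1. *)
Definition lead G a :=
  [/\ a.+1 < N, site a \in G, site a.+1 \in G & forall z, z \in G -> a <= pos z].

Definition tail G a := [set z in G | a.+1 < pos z].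

Definition slide G a t := site t |: (site t.+1 |: tail G a).

Lemma mem_slide G a t z : t.+1 < N ->
  (z \in slide G a t) = [|| pos z == t, pos z == t.+1 | (z \in G) && (a.+1 < pos z)].
Proof. by move=> tN; rewrite !inE !site_eq // ltnW. Qed.

Lemma slide_lead G a : lead G a -> slide G a a = G.
Proof.
case=> aN aG a1G low; apply/setP=> z; rewrite mem_slide //.
case: (eqVneq z (site a)) => [->|]; first by rewrite siteK ?(ltnW aN) // eqxx aG.
case: (eqVneq z (site a.+1)) => [->|]; first by rewrite siteK // eqxx orbT a1G.
rewrite !site_eq ?(ltnW aN) // => za1 za; rewrite (negPf za) (negPf za1) /=.
by apply: andb_idr => /low; lia.
Qed.

Lemma card_slide G a t : lead G a -> t <= a -> #|slide G a t| = #|tail G a|.+2.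
Proof.
case=> aN _ _ _ ta; have tN : t.+1 < N by apply: leq_ltn_trans aN.
rewrite !cardsU1 !inE !site_eq ?siteK ?(ltnW tN) //.
by rewrite (ltn_eqF (ltnSn t)) ![_ < t.+1]ltnNge ![_ < t]ltnNge ?ltnS; lia.
Qed.

Lemma below_slide G a t x : lead G a -> t <= a ->
  below (slide G a t) x = (t < pos x) + ((t.+1 < pos x) + below (tail G a) x).
Proof.
case=> aN _ _ _ ta; have tN : t.+1 < N by apply: leq_ltn_trans aN.
rewrite !below_setU1 ?siteK ?(ltnW tN) //; rewrite !inE ?site_eq ?siteK ?(ltnW tN) //; lia.
Qed.

(** The first vertex is a hole with nothing below it. *)
Lemma even_below G x : gale G -> site 0 \notin G -> pos x < N -> x \notin G ->
  odd (below G x) = false.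
Proof.
case/galeP=> _ _ [b par] G0 xN xG; have N0 : 0 < N by apply: leq_ltn_trans xN.
rewrite (par x) // -(par (site 0)) ?siteK // below_nil // => y.
by rewrite siteK.
Qed.

Lemma lead_exists G : gale G -> 0 < m -> site 0 \notin G ->
  exists2 a, 0 < a & lead G a.
Proof.
move=> gG m0 G0; have /galeP[cG GN _] := gG.
have /card_gt0P[x xG] : 0 < #|G| by rewrite cG double_gt0.
have [z zG zmin] := arg_minnP pos xG; have zN := GN _ zG.
have low y : y \in G -> pos z <= pos y by exact: zmin.
exists (pos z).
  rewrite lt0n; apply: contra G0 => /eqP z0.
  by rewrite -z0 (posK pos_inj siteK).
have z1N : (pos z).+1 < N.
  rewrite ltnNge; apply: contraL m0 => Nz.
  have /subset_leq_card : G \subset [set z].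
    apply/subsetP=> y yG; rewrite inE; apply/eqP/pos_inj.
    have := low _ yG; have := GN _ yG; lia.
  by rewrite cG cards1; lia.
split=> //; first by rewrite (posK pos_inj siteK).
apply: contraT => z1G.
have := even_below gG G0 _ z1G; rewrite siteK // => /(_ z1N).
suff -> : below G (site (pos z).+1) = 1 by [].
rewrite /below -(cards1 z); apply: eq_card => y; rewrite !inE siteK // ltnS.
apply/andP/eqP=> [[yG yz]|->]; last by split.
by apply: pos_inj; have := low _ yG; lia.
Qed.

Lemma slide_gale G a t : gale G -> site 0 \notin G -> lead G a -> t <= a ->
  gale (slide G a t).
Proof.
move=> gG G0 lG ta; have [aN _ _ _] := lG; have /galeP[cG GN _] := gG.
have tN : t.+1 < N by apply: leq_ltn_trans aN.
apply/galeP; split.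
- by rewrite card_slide // -cG -{2}(slide_lead lG) card_slide.
- by move=> x; rewrite mem_slide // => /or3P[/eqP->|/eqP->|/andP[/GN]]//; apply: ltnW.
exists false => x xN; rewrite mem_slide // !negb_or => /and3P[xt xt1 xG].
rewrite below_slide // !oddD !oddb.
case: (ltnP a.+1 (pos x)) xG => [ax|xa] xG.
  have {}xG : x \notin G by rewrite andbT in xG.
  have := even_below gG G0 xN xG; rewrite -{1}(slide_lead lG) below_slide // !oddD !oddb ax (ltnW ax).
  rewrite /= negbK => ->.
  have -> : t.+1 < pos x by apply: leq_ltn_trans ax.
  by have -> : t < pos x by apply: leq_ltn_trans (ltnW ax).
rewrite (below_nil (F := tail G a)) ?addbF /=; first by lia.
move=> y yx; rewrite !inE negb_and -leqNgt (leq_trans (ltnW yx)) ?orbT //.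
Qed.

(** The lowest pair of G' starts at most one position above that of G.  When it does,
    a was exchanged, the second element of the pair at a is in G', and the third
    element of G takes part in the new lowest pair. *)
Lemma near_slide G G' a a' t : near G G' -> lead G a -> lead G' a' ->
  near (slide G a t) (slide G' a' t).
Proof.
move=> nGG [aN aG a1G _] [a'N a'G' a1G' low'].
have sub : slide G a t :\: slide G' a' t \subset tail G a :\: tail G' a'.
  by apply/subsetP=> z; rewrite !inE !negb_or => /andP[/and3P[/negPf-> /negPf-> ->]].
apply: leq_trans (subset_leq_card sub) _; case: (leqP a' a) => [aa|aa].
  apply: leq_trans nGG; apply: subset_leq_card; apply/subsetP=> z.
  rewrite !inE => /andP[z1 /andP[zG z2]]; rewrite zG andbT; apply: contra z1 => ->.
  by lia.
have aG' : site a \notin G'.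
  by apply: contraL aa => /low'; rewrite siteK ?(ltnW aN) // -leqNgt.
have E : a' = a.+1.
  have a1 : site a.+1 \in G'.
    apply: near_mem nGG aG aG' a1G _; rewrite site_eq ?(ltnW aN) // siteK //.
    by rewrite (gtn_eqF (ltnSn a)).
  by apply/eqP; rewrite eqn_leq aa andbT; have := low' _ a1; rewrite siteK.
rewrite -(cards1 (site a.+2)); apply: subset_leq_card; apply/subsetP=> z.
rewrite !inE negb_and E => /andP[z1 /andP[zG z2]].
rewrite site_eq -?E //; case/orP: z1 => z1; last by rewrite E; lia.
have := near_uniq nGG zG z1 aG aG' => za.
by move: z2; rewrite za siteK ?(ltnW aN) //; lia.
Qed.

Lemma card_last_two L (S : {set T}) : N = L.+4 -> (forall z, z \in S -> pos z < N) ->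
  #|[set z in S | L.+2 <= pos z]| = (site L.+2 \in S) + (site L.+3 \in S).
Proof.
move=> LE SN; have L2N : L.+2 < N by rewrite LE.
have L3N : L.+3 < N by rewrite LE.
set A := [set _ in S | _].
rewrite (cardsD1 (site L.+2)) (cardsD1 (site L.+3)).
rewrite (_ : #|_| = 0) ?addn0; last first.
  apply/eqP; rewrite cards_eq0 -subset0; apply/subsetP=> z.
  rewrite !in_setD1 !site_eq // !inE => /and4P[z3 z2 /SN]; rewrite LE; clear -z3 z2; lia.
by rewrite in_setD1 !inE site_eq // !siteK // leqnn leqnSn !andbT gtn_eqF.
Qed.

(** When the first vertex enters G', the parities at the second and at the last vertex
    show that one of these two is in G: otherwise exactly one element of G' lies
    below the second vertex and all of them, an even number, below the last one. *)
Lemma neighbour_of_gap G G' : gale G' -> near G' G -> site 0 \in G' -> site 0 \notin G ->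
  1 < N -> site 1 \notin G -> site N.-1 \in G.
Proof.
move=> gG' nG'G G'0 G0 N1 nG1; apply: contraT => nLG.
have N0 := ltnW N1; have LN : N.-1 < N by rewrite prednK.
have other k : 0 < k < N -> site k \notin G -> site k \notin G'.
  case/andP=> k0 kN; apply: contra => kG'; apply: near_mem nG'G G'0 G0 kG' _.
  by rewrite site_eq // siteK // -lt0n.
have {nLG}nL : site N.-1 \notin G' by apply: other; rewrite // LN -subn1 subn_gt0 N1.
have {nG1}n1 : site 1 \notin G' by apply: other; rewrite // N1.
have /galeP[cG' GN' [b par]] := gG'.
have b1 : below G' (site 1) = 1.
  rewrite /below -[RHS](cards1 (site 0)); apply: eq_card => z; rewrite !inE siteK // site_eq //.
  rewrite ltnS leqn0; apply: andb_idl => /eqP z0.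
  by rewrite (_ : z = site 0) //; apply/eqP; rewrite site_eq // z0.
have bL : below G' (site N.-1) = m.*2.
  rewrite -cG'; apply: below_full => z zG'; have zN := GN' _ zG'.
  rewrite siteK // ltn_neqAle -ltnS prednK // zN andbT -site_eq //.
  by apply: contraTneq zG' => ->.
have e1 : odd (below G' (site 1)) = b by apply: par; rewrite ?siteK.
have eL : odd (below G' (site N.-1)) = b by apply: par; rewrite ?siteK.
by move: eL; rewrite -e1 b1 bL odd_double.
Qed.

(** The invariant carried along paths in Y: the lowest pair can be slid down inside Y
    as far as possible without covering the first vertex, but not further. *)
Definition inactive G a := [/\ lead G a, site 0 \notin G,
  forall t, 0 < t <= a -> Y (slide G a t) & ~~ Y (slide G a 0)].

(** The first vertex of G' comes from pushing over it either the lowest pair of G or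
    the last one; in the second case the lowest pair is free to slide afterwards.
    At least two pairs are needed for these to be different. *)
Lemma inactive_avoid G a G' : 1 < m -> inactive G a -> Y G -> Y G' -> near G G' ->
  site 0 \notin G'.
Proof.
move=> m1 [lG G0 sl nP] YG YG' nGG; apply/negP=> G'0.
have gG := Ygale YG; have gG' := Ygale YG'.
have /galeP[cG GN _] := gG; have /galeP[cG' _ _] := gG'.
have nG'G : near G' G by rewrite near_sym // cG.
have [aN aG a1G low] := lG; have N0 : 0 < N by apply: leq_ltn_trans aN.
have GG' : G != G' by apply: contraNneq G0 => ->.
have a0 : 0 < a by rewrite lt0n; apply: contraNneq G0 => <-.
have a1N : 1 < N by apply: leq_ltn_trans aN; rewrite ltnS.
have G'sub F : F \subset site 0 |: G -> near F G'.
  move=> FG; apply: leq_trans nGG; apply: subset_leq_card; apply/subsetP=> z.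
  rewrite !inE => /andP[zG' /(subsetP FG)]; rewrite !inE zG'.
  by case: eqP zG' => //= ->; rewrite G'0.
have step t z : z \in slide G a t -> z \in site t |: slide G a t.+1.
  by rewrite !inE => /or3P[->//|->|->]; rewrite ?orbT.
have gP : gale (slide G a 0) by apply: slide_gale.
have P1 : near (slide G a 0) (slide G a 1).
  by apply: (near_sub (u := site 0)); apply/subsetP=> z; apply: step.
case: (boolP (site 1 \in G)) => [G1|nG1].
  have a1 : a = 1.
    by apply/eqP; rewrite eqn_leq a0 andbT -[X in _ <= X](siteK a1N) low.
  subst a; move/negP: nP; apply; apply: (Yclosed gP YG YG' GG').
    by rewrite -{2}(slide_lead lG).
  by apply: G'sub; apply/subsetP=> z /step; rewrite slide_lead.
have a2 : 1 < a.
  by rewrite ltn_neqAle a0 andbT; apply: contraNneq nG1 => ->.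
have tailc : #|tail G a|.+2 = m.*2 by rewrite -cG -{2}(slide_lead lG) card_slide.
have aN3 : a.+3 < N.
  rewrite ltnNge; apply/negP=> Na.
  have /subset_leq_card : tail G a \subset [set site a.+2].
    apply/subsetP=> z; rewrite !inE => /andP[/GN zN az].
    have E : pos z = a.+2 by apply/eqP; rewrite eqn_leq az andbT -ltnS (leq_trans zN).
    by rewrite site_eq ?E // -E.
  rewrite cards1; move: tailc m1; clear; lia.
have [L LE] : exists L, N = L.+4 by exists (N - 4); move: aN3; clear; lia.
have L3N : L.+3 < N by rewrite LE.
have L2N : L.+2 < N by rewrite LE.
have aL : a <= L by move: aN3; rewrite LE.
have LG : site L.+3 \in G by have := neighbour_of_gap gG' nG'G G'0 G0; rewrite LE; apply.
have LG2 : site L.+2 \in G.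
  apply: contraT => nLG; have := even_below gG G0 _ nLG; rewrite siteK // => /(_ L2N).
  have := below_above pos G (site L.+2); rewrite cG siteK // card_last_two //.
  rewrite LG (negPf nLG) => /(congr1 odd); rewrite oddD odd_double /=.
  by case: (odd _).
(* the last pair pushed over the first vertex, the lowest pair slid to t *)
pose H t := site 0 |: slide G a t :\ site L.+2.
have L2s t : t <= a -> site L.+2 \in slide G a t.
  move=> ta; rewrite mem_slide; last by apply: leq_ltn_trans aN.
  by rewrite siteK // LG2 !ltnS aL !orbT.
have L3s t : t <= a -> site L.+3 \in slide G a t.
  move=> ta; rewrite mem_slide; last by apply: leq_ltn_trans aN.
  by rewrite siteK // LG !ltnS (leq_trans aL) // !orbT.
have s0 t : 0 < t <= a -> site 0 \notin slide G a t.
  case/andP=> t0 ta; rewrite mem_slide; last by apply: leq_ltn_trans aN.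
  by rewrite siteK // (negPf G0) /= orbF eq_sym -lt0n.
have gH t : 0 < t <= a -> gale (H t).
  move=> ta; have /andP[_ ta'] := ta; have gs := slide_gale gG G0 lG ta'.
  apply: (gale_swap (b := true)) => // [||| x xN x0 xs].
  - exact: L2s.
  - exact: s0.
  - by rewrite siteK.
  have px : (0 < pos x) by rewrite lt0n -site_eq.
  rewrite !siteK // px addbT.
  move: xs; rewrite in_setD1 negb_and negbK => /orP[/eqP xE|xs].
    rewrite xE siteK // ltnn addbF.
    have := below_above pos (slide G a t) (site L.+2); have /galeP[-> _ _] := gs.
    move/(congr1 odd); rewrite oddD odd_double.
    rewrite siteK // card_last_two // => [|z]; first by rewrite L2s // L3s //=; case: (odd _).
    by have /galeP[_ + _] := gs; apply.
  rewrite (even_below gs) ?s0 // ltnNge.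
  case: leqP => // Lx; have xE : x = site L.+3.
    apply/eqP; rewrite site_eq //; move: xN Lx; rewrite LE; clear; lia.
  by rewrite xE L3s in xs.
have H0 t : site 0 \in H t by rewrite !inE eqxx.
(* H a is next to G and G'; H t is next to H (t + 1) and to the slide at t *)
have YH t : t < a -> Y (H (a - t)).
  elim: t => [|t IHt] ta.
    rewrite subn0; apply: (Yclosed _ YG YG' GG'); first by apply: gH; rewrite a0 leqnn.
      by rewrite /H slide_lead //; apply: near_swap.
    apply: G'sub; rewrite /H slide_lead //; apply: setUS; exact: subD1set.
  have r0 : 0 < a - t.+1 <= a by rewrite subn_gt0 ta leq_subr.
  have E : a - t = (a - t.+1).+1 by rewrite subnS prednK // subn_gt0 ltnW.
  apply: (Yclosed (gH _ r0) (IHt (ltnW ta)) (sl _ r0)).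
  - by apply: contraNneq (s0 _ r0) => <-.
  - apply: (near_sub (u := site (a - t.+1))); rewrite E; apply/subsetP=> z.
    rewrite !in_setU1 !in_setD1 => /orP[->|/andP[-> /step]]; rewrite ?orbT //.
    by rewrite in_setU1 => /orP[->|->]; rewrite ?orbT.
  - by apply: near_swap; apply: L2s; rewrite leq_subr.
have Y1 : Y (slide G a 1) by apply: sl; rewrite a0.
have YH1 : Y (H 1).
  have := YH a.-1; rewrite prednK // leqnn => /(_ isT).
  by rewrite (_ : a - a.-1 = 1) //; move: a0; clear; lia.
move/negP: nP; apply; apply: (Yclosed gP Y1 YH1 _ P1).
  by apply: contraNneq (s0 1 _) => [->|]; rewrite ?H0 ?a0.
apply: (near_sub (u := site L.+2)); apply/subsetP=> z /step/setU1P[->|zs].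
  by rewrite in_setU1 H0 orbT.
by rewrite !in_setU1 in_setD1 zs andbT; case: eqP; rewrite ?orbT.
Qed.

(** Induction on decreasing t: the slide of G' at t is next to its slide at t + 1 and to
    the slide of G at t.  The latter exists because a' is at most a + 1. *)
Lemma inactive_step G a G' : 1 < m -> inactive G a -> Y G -> Y G' -> near G G' ->
  exists a', inactive G' a'.
Proof.
move=> m1 iG YG YG' nGG; have G'0 := inactive_avoid m1 iG YG YG' nGG.
have [lG G0 sl nP] := iG.
have gG := Ygale YG; have gG' := Ygale YG'.
have [a' a'0 lG'] := lead_exists gG' (ltnW m1) G'0.
have /galeP[cG GN _] := gG; have /galeP[cG' _ _] := gG'.
have nG'G : near G' G by rewrite near_sym // cG.
have [aN aG a1G low] := lG; have [a'N a'G' a1G' low'] := lG'.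
have N0 : 0 < N by apply: leq_ltn_trans aN.
have a0 : 0 < a by rewrite lt0n; apply: contraNneq G0 => <-.
have a'a : a' <= a.+1.
  case: (boolP (site a \in G')) => [/low'|naG'].
    by rewrite siteK ?(ltnW aN) // => /leqW.
  have /low' : site a.+1 \in G'.
    apply: near_mem nGG aG naG' a1G _; rewrite site_eq ?(ltnW aN) // siteK //.
    by rewrite gtn_eqF.
  by rewrite siteK.
have sl' t : t < a' -> Y (slide G' a' (a' - t)).
  elim: t => [|t IHt] ta; first by rewrite subn0 slide_lead.
  have r0 : 0 < a' - t.+1 by rewrite subn_gt0.
  have ra' : a' - t.+1 < a' by rewrite ltn_subrL.
  have ra : a' - t.+1 <= a by rewrite -ltnS (leq_trans ra').
  have E : a' - t = (a' - t.+1).+1 by rewrite subnS prednK // subn_gt0 ltnW.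
  have YG1 : Y (slide G a (a' - t.+1)) by apply: sl; rewrite r0.
  have gs : gale (slide G' a' (a' - t.+1)) by apply: slide_gale => //; apply: ltnW.
  have rN : (a' - t.+1).+1 < N by apply: leq_ltn_trans a'N; rewrite ltnW // ltnS.
  apply: (Yclosed gs (IHt (ltnW ta)) YG1).
  - have sin : site (a' - t.+1) \in slide G a (a' - t.+1) by exact: setU11.
    apply: contraTneq sin => <-.
    rewrite E mem_slide; last by apply: leq_ltn_trans a'N; rewrite ltnS.
    rewrite siteK ?(ltnW rN) // !ltn_eqF ?leqnSn //= negb_and -leqNgt ltnW ?orbT //.
    by rewrite ltnW // ltnS ltnW.
  - apply: (near_sub (u := site (a' - t.+1))); rewrite E; apply/subsetP=> z.
    by rewrite !inE => /or3P[->//|->|->]; rewrite ?orbT.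
  - exact: near_slide.
exists a'; split=> // [t /andP[t0 ta']|].
  by have := sl' (a' - t); rewrite subKn // ltn_subrL t0 a'0 => /(_ isT).
apply: contra nP => YP.
have gP : gale (slide G a 0) by apply: slide_gale.
have Y1 : Y (slide G a 1) by apply: sl; rewrite a0.
apply: (Yclosed gP YP Y1).
- have sin : site 0 \in slide G' a' 0 by exact: setU11.
  apply: contraTneq sin => ->.
  rewrite mem_slide; last by apply: leq_ltn_trans aN; rewrite ltnS.
  by rewrite siteK // (negPf G0).
- exact: near_slide.
apply: (near_sub (u := site 0)); apply/subsetP=> z.
by rewrite !inE => /or3P[->//|->|->]; rewrite ?orbT.
Qed.

(** With a single pair there is nothing to slide: a facet of Y through the first vertex
    shares this vertex, which is a ridge, with the slide of G0 at 0. *)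
Lemma even_core G0 : Y G0 -> site 0 \notin G0 -> site 1 \in G0 -> 1 < N -> 0 < m ->
    ~~ Y (slide G0 1 0) -> (forall G, Y G -> connect (near_in Y) G0 G) ->
  forall G, Y G -> site 0 \notin G.
Proof.
move=> YG0 G00 G01 N1 m0 nP conn G YG.
have gG0 := Ygale YG0; have [a a0 lG0] := lead_exists gG0 m0 G00.
have [aN aG a1G low] := lG0.
have a1 : a = 1 by apply/eqP; rewrite eqn_leq a0 andbT -[X in _ <= X](siteK N1) low.
subst a; have gP : gale (slide G0 1 0) by apply: slide_gale.
have nP0 : near (slide G0 1 0) G0.
  rewrite -{2}(slide_lead lG0); apply: (near_sub (u := site 0)); apply/subsetP=> z.
  by rewrite !inE => /or3P[->//|->|->]; rewrite ?orbT.
case: (ltngtP 1 m) m0 => // m1 _; last first.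
  apply: contra nP => G0'; apply: (Yclosed gP YG0 YG _ nP0).
    by apply: contraNneq G00 => ->.
  have /galeP[cP _ _] := gP; rewrite card_slide // -m1 in cP; case: cP => /cards0_eq t0.
  apply: (near_sub (u := site 1)); apply/subsetP=> z.
  by rewrite /slide t0 setU0 !inE => /orP[/eqP->|->//]; rewrite G0' orbT.
have iG0 : inactive G0 1.
  split=> // t /andP[t0 t1]; rewrite (_ : t = 1); first by rewrite slide_lead.
  by apply/eqP; rewrite eqn_leq t1.
have /connectP[p + ->] := conn G YG.
elim: p (G0) (1) YG0 iG0 => [|F p IHp] K a YK iK /=; first by case: iK.
case/andP=> /and3P[_ YF KF] pF; have [a' iF] := inactive_step m1 iK YK YF KF.
exact: IHp YF iF pF.
Qed.

End EvenCore.

(** * Rotations and reflections of the cyclic order *)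

Section Reorder.
Variables (T : finType) (N : nat).
Implicit Types (p q : T -> nat) (F : {set T}).

Lemma gale_parity p q d F c : (forall x, (q x < N) = (p x < N)) ->
    (forall x, p x < N -> x \notin F ->
       odd (below q F x) = odd (below p F x) (+) c) ->
  gale p N d F -> gale q N d F.
Proof.
move=> pq par /galeP[cF FN [b bP]]; apply/galeP; split=> //.
  by move=> x /FN; rewrite pq.
by exists (b (+) c) => x; rewrite pq => xN xF; rewrite par // bP.
Qed.

Lemma gale_parityE p q m F (c : {set T} -> bool) : (forall x, (q x < N) = (p x < N)) ->
    (forall x, (forall z, z \in F -> p z < N) -> #|F| = m.*2 -> p x < N -> x \notin F ->
       odd (below q F x) = odd (below p F x) (+) c F) ->
  gale q N m.*2 F = gale p N m.*2 F.
Proof.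
move=> pq par; apply/idP/idP=> g; have /galeP[cF FN _] := g.
  apply: (gale_parity (c := c F)) g => x; first by rewrite pq.
  rewrite pq => xN xF; rewrite par // ?addbK // => z /FN; rewrite pq //.
by apply: (gale_parity (c := c F)) g => // x xN xF; rewrite par.
Qed.

Variables (pos : T -> nat) (site : nat -> T).
Hypothesis pos_inj : injective pos.
Hypothesis siteK : forall k, k < N -> pos (site k) = k.

Definition mirror x := if pos x < N then N.-1 - pos x else pos x.

Lemma mirror_lt x : (mirror x < N) = (pos x < N).
Proof. by rewrite /mirror; case: (ltnP (pos x) N) => xN; lia. Qed.

Lemma mirror_inj : injective mirror.
Proof.
move=> x y; rewrite /mirror => E; apply: pos_inj; move: E.
by case: (ltnP (pos x) N) => xN; case: (ltnP (pos y) N) => yN; lia.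
Qed.

Lemma mirror_site k : k < N -> mirror (site (N.-1 - k)) = k.
Proof. by move=> kN; rewrite /mirror siteK; [case: ltnP => ?; lia | lia]. Qed.

(** Below and above have the same parity at a hole, because F has even size. *)
Lemma gale_mirror m F : gale mirror N m.*2 F = gale pos N m.*2 F.
Proof.
apply: (gale_parityE (c := fun=> false)); first exact: mirror_lt.
move=> x FN cF xN xF; rewrite addbF.
have := below_above pos F x; rewrite cF => /(congr1 odd); rewrite oddD odd_double.
suff -> : #|[set z in F | pos x <= pos z]| = below mirror F x.
  by do 2 case: (odd _).
apply: eq_card => z; rewrite !inE; case: (boolP (z \in F)) => //= zF.
have zN := FN _ zF; have zx : pos z != pos x by apply: contraNneq xF => /pos_inj <-.
by rewrite /mirror zN xN; move: zx zN xN; clear; lia.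
Qed.

Variable v : T.
Hypothesis vN : pos v < N.

Definition turn x :=
  if pos x < N then if pos v <= pos x then pos x - pos v else pos x + N - pos v
  else pos x.

Lemma turn_lt x : (turn x < N) = (pos x < N).
Proof. by rewrite /turn; case: (ltnP (pos x) N) => xN; case: (leqP (pos v) (pos x)) => vx; lia. Qed.

Lemma turn_inj : injective turn.
Proof.
move=> x y; rewrite /turn => E; apply: pos_inj; move: E vN.
case: (ltnP (pos x) N) => xN; case: (ltnP (pos y) N) => yN;
  case: (leqP (pos v) (pos x)) => vx; case: (leqP (pos v) (pos y)) => vy; lia.
Qed.

Definition turn_site k :=
  if k + pos v < N then site (k + pos v) else site (k + pos v - N).

Lemma turn_siteK k : k < N -> turn (turn_site k) = k.
Proof.
move=> kN; rewrite /turn_site /turn; case: (ltnP (k + pos v) N) => kv.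
  by rewrite siteK // kv leq_addl addnK.
have kvN : k + pos v - N < N by lia.
by rewrite siteK // kvN; case: (leqP (pos v) (k + pos v - N)) => ?; lia.
Qed.

(** Turning the cycle changes all the counts by the number of elements of F below the
    new first vertex, up to the even number #|F|. *)
Lemma gale_turn m F : gale turn N m.*2 F = gale pos N m.*2 F.
Proof.
apply: (gale_parityE (c := fun F => odd (below pos F v))); first exact: turn_lt.
move=> x FN cF xN xF; case: (leqP (pos v) (pos x)) => vx.
  rewrite (below_split F vx) oddD addbAC addbb addFb; congr (odd _).
  apply: eq_card => z; rewrite !inE; case: (boolP (z \in F)) => //= zF.
  rewrite /turn (FN _ zF) xN vx; case: (leqP (pos v) (pos z)) => vz;
    move: (FN _ zF) xN vN vx vz; clear; lia.
have := below_above pos F v; rewrite cF => /(congr1 odd); rewrite oddD odd_double.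
suff -> : below turn F x = #|[set z in F | pos v <= pos z]| + below pos F x.
  by rewrite oddD; do 3 case: (odd _).
rewrite /below -(cardsID [set z | pos v <= pos z] [set u in F | turn u < turn x]).
by congr addn; apply: eq_card => z; rewrite !inE; case: (boolP (z \in F)) => zF;
  rewrite /= ?andbF //;
  rewrite /turn (FN _ zF) xN (leqNgt (pos v) (pos x)) vx /=;
  case: (leqP (pos v) (pos z)) => vz; move: (FN _ zF) xN vN vx vz; clear; lia.
Qed.

End Reorder.

Section EvenAvoid.
Variables (T : finType) (N m : nat) (Y : pred {set T}).
Implicit Types (pos : T -> nat) (site : nat -> T) (F G : {set T}).

Lemma even_avoid_right pos site F0 G0 v :
    injective pos -> (forall k, k < N -> pos (site k) = k) ->
    (forall F, Y F -> gale pos N m.*2 F) -> two_closed pos N m.*2 Y ->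
    gale pos N m.*2 F0 -> ~~ Y F0 -> Y G0 -> near F0 G0 -> v \in F0 -> v \notin G0 ->
    (forall G, Y G -> connect (near_in Y) G0 G) -> 1 < N ->
    turn_site N pos site v 1 \in G0 ->
  forall G, Y G -> v \notin G.
Proof.
move=> pos_inj siteK Yg Ycl gF0 nF0 YG0 nFG vF vG conn N1 G01.
have /galeP[cF0 FN _] := gF0; have vN := FN _ vF.
set p := turn N pos v; set s := turn_site N pos site v.
have p_inj : injective p by apply: turn_inj.
have sK k : k < N -> p (s k) = k by apply: turn_siteK.
have Yg' F : Y F -> gale p N m.*2 F by rewrite gale_turn //; apply: Yg.
have Ycl' : two_closed p N m.*2 Y.
  by move=> F G1 G2; rewrite gale_turn //; apply: Ycl.
have N0 := ltnW N1.
have s0 : s 0 = v by rewrite /s /turn_site add0n vN (posK pos_inj siteK).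
have m0 : 0 < m.
  by rewrite -double_gt0 -cF0; apply/card_gt0P; exists v.
rewrite -s0 in vF vG *; apply: (even_core p_inj sK Yg' Ycl' YG0) => //.
have gG0 := Yg' _ YG0; have [a a0 lG0] := lead_exists p_inj sK gG0 m0 vG.
have [aN aG a1G low] := lG0.
have a1 : a = 1 by apply/eqP; rewrite eqn_leq a0 andbT -[X in _ <= X](sK _ N1) low.
subst a; apply: contra nF0 => YP; apply: (Ycl _ _ _ gF0 YG0 YP) => //.
  by apply: contraNneq vG => ->; apply: setU11.
apply: (near_sub (u := s 2)); apply/subsetP=> z zF.
case: (eqVneq z (s 0)) => [->|z0]; first by rewrite !inE eqxx orbT.
have := near_mem nFG vF vG zF z0; rewrite -{1}(slide_lead p_inj sK lG0).
by rewrite !inE => /or3P[] ->; rewrite ?orbT.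
Qed.

(** After turning v to the first position, G0 contains the second or the last vertex;
    in the latter case the order is reversed. *)
Theorem even_avoid pos site F0 G0 :
    injective pos -> (forall k, k < N -> pos (site k) = k) ->
    (forall F, Y F -> gale pos N m.*2 F) -> two_closed pos N m.*2 Y ->
    gale pos N m.*2 F0 -> ~~ Y F0 -> Y G0 -> near F0 G0 ->
    (forall G, Y G -> connect (near_in Y) G0 G) ->
  exists2 v, (v \in F0) && (v \notin G0) & forall G, Y G -> v \notin G.
Proof.
move=> pos_inj siteK Yg Ycl gF0 nF0 YG0 nFG conn.
have gG0 := Yg _ YG0; have /galeP[cF0 FN _] := gF0; have /galeP[cG0 GN _] := gG0.
have [v vF vG] : exists2 v, v \in F0 & v \notin G0.
  apply/subsetPn; apply: contra nF0 => sub; suff -> : F0 = G0 by [].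
  by apply/eqP; rewrite eqEcard sub cF0 cG0 /=.
exists v; first by rewrite vF.
have vN := FN _ vF.
have N1 : 1 < N.
  have m0 : 1 < m.*2.
    have : 0 < #|F0| by apply/card_gt0P; exists v.
    by rewrite cF0; clear; lia.
  apply: leq_trans m0 _; rewrite -cF0 -(card_ground pos_inj siteK).
  by apply: subset_leq_card; apply/subsetP=> z /FN; rewrite inE.
case: (boolP (turn_site N pos site v 1 \in G0)) => [|n1].
  exact: (even_avoid_right pos_inj siteK Yg Ycl gF0).
set p := turn N pos v; set s := turn_site N pos site v.
have p_inj : injective p by apply: turn_inj.
have sK k : k < N -> p (s k) = k by apply: turn_siteK.
have s0 : s 0 = v by rewrite /s /turn_site add0n vN (posK pos_inj siteK).
have last_in : s N.-1 \in G0.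
  apply: (@neighbour_of_gap T p p_inj N s sK m G0 F0) => //; rewrite ?s0 //.
  by rewrite gale_turn.
have mK k : k < N -> mirror N pos (site (N.-1 - k)) = k by apply: mirror_site.
apply: (even_avoid_right (pos := mirror N pos) (site := fun k => site (N.-1 - k)) _ mK _ _ _ nF0 YG0) => //.
- exact: mirror_inj.
- by move=> F /Yg; rewrite gale_mirror.
- by move=> F G1 G2; rewrite gale_mirror //; apply: Ycl.
- by rewrite gale_mirror.
rewrite (_ : turn_site _ _ _ _ _ = s N.-1) // /s /turn_site /mirror vN.
move: vN N1; case: (posnP (pos v)) => [->|v0] vN N1.
  by rewrite subn0 addn0; case: ifP; [lia|case: ifP => ?; [move=> _; congr site|]; lia].
rewrite (_ : 1 + (N.-1 - pos v) < N); last by lia.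
rewrite (_ : (N.-1 + pos v < N) = false); last by lia.
by congr site; lia.
Qed.

End EvenAvoid.

(** * Odd dimension *)

Section OddAvoid.
Variables (T : finType) (pos : T -> nat).
Hypothesis pos_inj : injective pos.
Variables (M m : nat) (site : nat -> T).
Hypothesis siteK : forall k, k < M.+1 -> pos (site k) = k.
Hypothesis M0 : 0 < M.
Implicit Types (F G K : {set T}).

Local Notation d := m.*2.+1.
Local Notation gale' := (gale pos M m.*2).
Local Notation gale := (gale pos M.+1 d).
Local Notation below := (below pos).
Local Notation first := (site 0).
Local Notation last := (site M).
Local Notation site_eq := (site_eq pos_inj siteK).

Lemma below_first F : below F first = 0.
Proof. by apply: below_nil => y; rewrite siteK. Qed.

Lemma below_last F : (forall x, x \in F -> pos x < M.+1) ->
  below F last + (last \in F) = #|F|.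
Proof.
move=> FN; rewrite -(below_above pos F last) siteK //; congr addn.
case: (boolP (last \in F)) => lF.
  rewrite -[LHS](cards1 last); apply: eq_card => z; rewrite !inE site_eq //.
  apply/eqP/andP=> [zM|[/FN zF Mz]]; last by apply/eqP; rewrite eqn_leq Mz -ltnS zF.
  by rewrite (_ : z = last) ?siteK //; apply/eqP; rewrite site_eq // zM.
apply/esym/eqP; rewrite cards_eq0 -subset0; apply/subsetP=> z; rewrite !inE.
case/andP=> zF Mz; have zM := FN _ zF.
rewrite (_ : z = last) ?(negPf lF) // in zF.
by apply/eqP; rewrite site_eq // eqn_leq Mz -ltnS zM.
Qed.

(** For odd d all the counts at holes are even when the first vertex is missing, while
    the count at a missing last vertex is d. *)
Lemma gale_no_first F : gale F -> first \notin F -> last \in F /\ gale (first |: F :\ last).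
Proof.
move=> gF fF; have /galeP[cF FN [b par]] := gF.
have bF : b = false by rewrite -(par first) ?siteK // below_first.
have := below_last FN; rewrite cF; case: (boolP (last \in F)) => lF; rewrite ?addn1 ?addn0.
  case=> bl; split=> //; apply: (gale_swap (b := true)) => //; first by rewrite siteK.
  move=> x xN x0; rewrite in_setD1 negb_and negbK !siteK // ltnNge -ltnS xN /= addbF.
  rewrite [0 < _]lt0n -site_eq // x0 addbT => /orP[/eqP->|xF]; first by rewrite bl odd_double.
  by rewrite par // bF.
move=> bl; have := par last; rewrite siteK // bl bF /= odd_double => /(_ (ltnSn M) lF).
by [].
Qed.

Lemma gale_no_last F : gale F -> last \notin F -> first \in F /\ gale (last |: F :\ first).
Proof.
move=> gF lF; have /galeP[cF FN [b par]] := gF.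
have bT : b = true.
  have := below_last FN; rewrite cF (negPf lF) addn0 => bl.
  by rewrite -(par last) ?siteK // bl /= odd_double.
have fF : first \in F.
  by apply: contraT => fF; have := par first; rewrite siteK // below_first bT => /(_ isT fF).
split=> //; apply: (gale_swap (b := false)) => //; first by rewrite siteK.
move=> x xN xl; rewrite in_setD1 negb_and negbK !siteK // [M < _]ltnNge -[pos x <= M]ltnS xN /= addbF.
case: (eqVneq x first) => [->|x0] /=; first by rewrite below_first siteK.
by move=> xF; rewrite par // bT lt0n -site_eq // x0.
Qed.

Variable Y : pred {set T}.
Hypothesis Ygale : forall F, Y F -> gale F.
Hypothesis Yclosed : two_closed pos M.+1 d Y.

(** Trading e' for e maps facets avoiding e to facets containing e, and neighbours to
    neighbours.  The traded image of G0 is not in Y, else F0 would be next to two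
    facets of Y; this persists along a path in Y, and forbids e to appear. *)
Lemma exchange_avoid e e' F0 G0 :
    (forall F, gale F -> e \notin F -> e' \in F /\ gale (e |: F :\ e')) ->
    gale F0 -> ~~ Y F0 -> Y G0 -> near F0 G0 -> e \in F0 -> e \notin G0 ->
    (forall G, Y G -> connect (near_in Y) G0 G) ->
  forall G, Y G -> e \notin G.
Proof.
move=> exch gF0 nF0 YG0 nFG eF eG conn G YG.
have dist (A B : {set T}) : e \notin A -> e \in B -> A != B.
  by move=> eA eB; apply: contraNneq eA => ->.
have eP (A : {set T}) : e \in e |: A by exact: setU11.
have nP0 : ~~ Y (e |: G0 :\ e').
  apply: contra nF0 => YP; apply: (Yclosed gF0 YG0 YP) => //; first exact: dist.
  apply: (near_sub (u := e')); apply/subsetP=> z zF; rewrite !inE.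
  case: (eqVneq z e) => [_|ze]; first by rewrite orbT.
  by rewrite (near_mem nFG eF eG zF ze) andbT; case: eqP.
have /connectP[p + ->] := conn G YG.
elim: p G0 {conn F0 gF0 nF0 eF nFG} YG0 eG nP0 => [|F p IHp] K YK eK nP //=.
case/andP=> /and3P[_ YF KF] pF; have [e'K gP] := exch _ (Ygale YK) eK.
have PK : near (e |: K :\ e') K by apply: near_swap.
have eF : e \notin F.
  apply: contra nP => eF; apply: (Yclosed gP YK YF) => //; first exact: dist.
  apply: leq_trans KF; apply: subset_leq_card; apply/subsetP=> z; rewrite !inE.
  by case: (eqVneq z e) => [->|_] /=; [rewrite eF | case/and3P=> -> _ ->].
apply: (IHp F YF eF) pF; apply: contra nP => YP.
apply: (Yclosed gP YK YP) => //; first exact: dist.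
apply: leq_trans KF; apply: subset_leq_card; apply/subsetP=> z; rewrite !inE negb_or.
by rewrite negb_and negbK; case/andP=> /andP[/negPf-> /orP[/eqP->|->]] /=; rewrite ?eqxx // => /andP[].
Qed.

(** The facets of the even-dimensional cyclic polytope on the positions below M
    correspond to the facets of the odd-dimensional one after contraction of the
    edge joining the two end vertices.  A contracted facet without the first vertex
    comes from two facets; [expand] selects the one containing the first vertex. *)
Definition expand K := if first \in K then last |: K else first |: K.
Definition contract G := if first \in G then if last \in G then G :\ last else G :\ first
                     else G :\ last.

Lemma expand_gale K : gale' K -> gale (expand K).
Proof.
move=> gK; have /galeP[cK KM [b par]] := gK.
have lK : last \notin K by apply/negP=> /KM; rewrite siteK // ltnn.
have eqM x : pos x < M.+1 -> x != last -> pos x < M.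
  by move=> xM xl; rewrite ltn_neqAle -ltnS xM andbT -site_eq.
apply/galeP; rewrite /expand; case: ifPn => fK; split.
- by rewrite cardsU1 lK cK.
- by move=> x; rewrite !inE => /orP[/eqP->|/KM]; rewrite ?siteK // => /ltnW.
- exists b => x xM; rewrite in_setU1 negb_or => /andP[xl xK].
  by rewrite below_setU1 // siteK // ltnNge -ltnS xM add0n par // eqM.
- by rewrite cardsU1 fK cK.
- by move=> x; rewrite !inE => /orP[/eqP->|/KM]; rewrite ?siteK // => /ltnW.
exists true => x xM; rewrite in_setU1 negb_or => /andP[xf xK].
rewrite below_setU1 // siteK // lt0n -site_eq // xf oddD /=.
case: (eqVneq x last) => [->|xl].
  have := below_last (F := K); rewrite (negPf lK) addn0 cK => ->; rewrite ?odd_double //.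
  by move=> z /KM /ltnW.
rewrite par ?eqM //; have := par first; rewrite siteK // below_first => /(_ M0 fK) <-.
by [].
Qed.

Lemma first_neq_last : first != last.
Proof. by rewrite site_eq // siteK // eq_sym -lt0n. Qed.

Lemma last_notin K : gale' K -> last \notin K.
Proof. by case/galeP=> _ KM _; apply/negP=> /KM; rewrite siteK // ltnn. Qed.

Lemma expand_inj K K' : gale' K -> gale' K' -> expand K = expand K' -> K = K'.
Proof.
have fl := first_neq_last; move=> /last_notin lK /last_notin lK' E.
have lE (A : {set T}) : last \notin A -> (last \in expand A) = (first \in A).
  move=> lA; rewrite /expand; case: ifP => _; rewrite !inE ?eqxx ?(negPf lA) //.
  by rewrite eq_sym (negPf fl).
have fE : (first \in K) = (first \in K') by rewrite -!lE // E.
move: E; rewrite /expand -fE; case: ifP => fK E.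
  by rewrite -(setU1K lK) E setU1K.
by rewrite -[K](@setU1K _ first) ?fK // E setU1K // -fE fK.
Qed.

Lemma near_expand K K' : gale' K -> gale' K' -> near K K' -> near (expand K) (expand K').
Proof.
move=> /last_notin lK /last_notin lK' nKK; have fl := first_neq_last.
rewrite /expand; case: ifPn => fK; case: ifPn => fK'.
- apply: leq_trans nKK; apply: subset_leq_card; apply/subsetP=> z; rewrite !inE.
  by case: (z == last).
- apply: (near_sub (u := last)); apply/subsetP=> z; rewrite !inE.
  case/orP=> [->//|zK]; case: (eqVneq z first) => [|z0]; rewrite ?orbT //.
  by rewrite (near_mem nKK fK fK' zK z0) !orbT.
- apply: leq_trans nKK; apply: subset_leq_card; apply/subsetP=> z; rewrite !inE.
  rewrite negb_or => /andP[/andP[_ zK']]; rewrite zK'.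
  by case: eqP zK' => [->|] //=; rewrite fK'.
apply: leq_trans nKK; apply: subset_leq_card; apply/subsetP=> z; rewrite !inE.
by case: (z == first).
Qed.

Lemma contract_gale G : gale G -> gale' (contract G).
Proof.
move=> gG; have /galeP[cG GN [b par]] := gG.
have drop (u : T) : u \in G -> #|G :\ u| = m.*2.
  by move=> uG; apply/eqP; rewrite -eqSS -cG (cardsD1 u G) uG.
have nl x : x \in G -> x != last -> pos x < M.
  by move=> /GN xM; rewrite site_eq // ltn_neqAle -ltnS xM andbT.
have noM x : pos x < M -> x != last by move=> xM; rewrite site_eq // ltn_eqF.
have dropl : last \in G -> gale' (G :\ last).
  move=> lG; apply/galeP; split; first exact: drop.
    by move=> x; rewrite !inE => /andP[xl /nl]; apply.
  exists b => x xM; rewrite !inE noM //= => xG.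
  have := below_setD1 pos x lG; rewrite siteK // ltnNge (ltnW xM) add0n => <-.
  by apply: par => //; apply: ltnW.
rewrite /contract; case: ifPn => fG; last by apply: dropl; case: (gale_no_first gG fG).
case: ifPn => lG; first exact: dropl.
apply/galeP; split; first exact: drop.
  move=> x; rewrite !inE => /andP[_ xG]; apply: nl => //.
  by apply: contraNneq lG => <-.
have bT : b = true.
  rewrite -(par last) ?siteK //; have := below_last GN.
  by rewrite cG (negPf lG) addn0 => ->; rewrite /= odd_double.
exists false => x xM; rewrite !inE negb_and negbK => /orP[/eqP->|xG].
  by rewrite below_nil // => y; rewrite siteK.
have x0 : 0 < pos x by rewrite lt0n -site_eq //; apply: contraNneq xG => ->.
have := par x (ltnW xM) xG; rewrite bT (below_setD1 pos x fG) siteK // x0 oddD /=.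
by move/negbTE.
Qed.

Lemma expand_contract G : gale G ->
  expand (contract G) = if first \in G then G else first |: G :\ last.
Proof.
move=> gG; have fl := first_neq_last; rewrite /contract; case: ifPn => fG.
  case: ifPn => lG; rewrite /expand !inE ?fG ?fl ?eqxx /=; exact: setD1K.
by rewrite /expand !inE (negPf fG) andbF.
Qed.

Lemma near_contract G G' : gale G -> gale G' -> near G G' -> near (contract G) (contract G').
Proof.
move=> gG gG' nGG; have fl := first_neq_last.
have nFL : first \notin G -> last \in G by move=> /(gale_no_first gG)[].
have nFL' : first \notin G' -> last \in G' by move=> /(gale_no_first gG')[].
have sub (A B : {set T}) : A :\: B \subset G :\: G' -> near A B.
  by move=> AB; apply: leq_trans nGG; apply: subset_leq_card.
rewrite /contract; case: (boolP (first \in G)) => fG; case: (boolP (first \in G')) => fG'.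
- case: ifPn => lG; case: ifPn => lG'.
  + apply: sub; apply/subsetP=> z; rewrite !inE.
    by case: (z == last).
  + apply: (near_sub (u := first)); apply/subsetP=> z; rewrite !inE => /andP[zl zG].
    by rewrite (near_mem nGG lG lG' zG zl) andbT; case: eqP.
  + apply: sub; apply/subsetP=> z; rewrite !inE.
    case: (eqVneq z last) => [->|] /=; first by rewrite (negPf lG) !andbF.
    by move=> _ /and3P[-> _ ->].
  + apply: sub; apply/subsetP=> z; rewrite !inE.
    by case: (z == first).
- have lG' := nFL' fG'; case: ifPn => lG.
    apply: sub; apply/subsetP=> z; rewrite !inE.
    by case: (z == last).
  apply: sub; apply/subsetP=> z; rewrite !inE.
  case: (eqVneq z last) => [->|] /=; first by rewrite (negPf lG) !andbF.
  by move=> _ /and3P[-> _ ->].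
- have lG := nFL fG; case: ifPn => lG'.
    apply: sub; apply/subsetP=> z; rewrite !inE.
    by case: (z == last).
  apply: (near_sub (u := first)); apply/subsetP=> z; rewrite !inE => /andP[zl zG].
  by rewrite (near_mem nGG lG lG' zG zl) andbT; case: eqP.
apply: sub; apply/subsetP=> z; rewrite !inE.
by case: (z == last).
Qed.

(** If no facet outside Y is separated from a neighbour in Y by one of the end vertices,
    Y is stable under trading the last vertex for the first, so Y is the preimage
    of its contraction and the latter is two_closed and connected. *)
Theorem odd_avoid F0 G0 : gale F0 -> ~~ Y F0 -> Y G0 -> near F0 G0 ->
    (forall G, Y G -> connect (near_in Y) G0 G) ->
  exists v F, [/\ gale F, v \in F & forall G, Y G -> v \notin G].
Proof.
move=> gF0 nF0 YG0 nFG conn.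
have conn' A B : Y A -> Y B -> connect (near_in Y) A B.
  move=> YA YB; apply: connect_trans (conn B YB).
  have sY : symmetric (near_in Y).
    move=> C D; rewrite /near_in andbCA.
    case: (boolP (Y D)) => //= YD; case: (boolP (Y C)) => //= YC.
    by have /galeP[cC _ _] := Ygale YC; have /galeP[cD _ _] := Ygale YD; rewrite near_sym ?cC.
  by rewrite (sym_connect_sym sY); apply: conn.
(* the end vertex e separates two neighbouring facets on different sides of Y *)
pose crossing e := [exists A, exists B,
  [&& gale A, ~~ Y A, Y B, near A B, e \in A & e \notin B]].
have cross e e' : (forall F, gale F -> e \notin F -> e' \in F /\ gale (e |: F :\ e')) ->
    crossing e -> exists v F, [/\ gale F, v \in F & forall G, Y G -> v \notin G].
  move=> exch /existsP[A /existsP[B /and5P[gA nA YB nAB /andP[eA eB]]]].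
  exists e, A; split=> //; apply: (exchange_avoid exch gA nA YB) => // G; exact: conn'.
case: (boolP (crossing first)) => [|ncf]; first by apply: (cross _ last) => F; apply: gale_no_first.
case: (boolP (crossing last)) => [|ncl]; first by apply: (cross _ first) => F; apply: gale_no_last.
have nocross e A B : ~~ crossing e -> gale A -> ~~ Y A -> Y B -> near A B ->
    e \in A -> e \notin B -> False.
  move=> nc gA nA YB nAB eA eB; move/negP: nc; apply; apply/existsP; exists A.
  by apply/existsP; exists B; rewrite gA nA YB nAB eA.
have Yswap G : Y G -> first \notin G -> Y (first |: G :\ last).
  move=> YG fG; apply: contraT => nY; have [lG gS] := gale_no_first (Ygale YG) fG.
  case: (nocross first _ G ncf gS nY YG) => //; [exact: near_swap | exact: setU11].
pose Y' K := gale' K && Y (expand K).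
have Y'contract G : Y G -> Y' (contract G).
  move=> YG; rewrite /Y' contract_gale ?Ygale // expand_contract ?Ygale //.
  by case: ifPn => // /Yswap; apply.
have siteK' k : k < M -> pos (site k) = k by move=> kM; rewrite siteK // ltnW.
have Y'gale K : Y' K -> gale' K by case/andP.
have Y'closed : two_closed pos M m.*2 Y'.
  move=> K K1 K2 gK /andP[gK1 YK1] /andP[gK2 YK2] K12 nK1 nK2; rewrite /Y' gK /=.
  apply: (Yclosed (expand_gale gK) YK1 YK2); try exact: near_expand.
  by apply: contra_neq K12 => /expand_inj; apply.
have nF0' : ~~ Y' (contract F0).
  rewrite /Y' contract_gale //= expand_contract //; case: ifPn => // fF.
  apply/negP=> YS; have [lF _] := gale_no_first gF0 fF.
  apply: (nocross last F0 _ ncl gF0 nF0 YS) => //; first exact: near_swap'.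
  by rewrite !inE eqxx eq_sym (negPf first_neq_last).
have conn0 K : Y' K -> connect (near_in Y') (contract G0) K.
  case/andP=> gK YK; have -> : K = contract (expand K).
    have lK := last_notin gK; have fl := first_neq_last.
    rewrite /contract /expand; case: (boolP (first \in K)) => fK; rewrite !inE eqxx ?fK ?orbT /=.
      by rewrite setU1K.
    by rewrite eq_sym (negPf fl) (negPf lK) /= setU1K.
  have /connectP[p + ->] := conn _ YK; elim: p (G0) => [|A p IHp] B //=.
  case/andP=> /and3P[YB YA nBA] pA; apply: connect_trans (IHp _ pA).
  by apply: connect1; rewrite /near_in !Y'contract // near_contract ?Ygale.
have [v /andP[vF vG] vY'] := even_avoid pos_inj siteK' Y'gale Y'closed
  (contract_gale gF0) nF0' (Y'contract _ YG0) (near_contract gF0 (Ygale YG0) nFG) conn0.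
have contractS G : contract G \subset G by rewrite /contract; case: ifP => _; [case: ifP => _|]; exact: subD1set.
have vF0 := subsetP (contractS F0) v vF.
have vM : pos v < M by have /galeP[_ + _] := contract_gale gF0; apply.
(* the contracted vertex cannot be the avoided one: F0 would contain both ends, G0 not *)
exists v, F0; split=> // G YG; case: (eqVneq v first) => [v0|v0]; last first.
  apply: contra (vY' _ (Y'contract _ YG)) => vGG; rewrite /contract.
  have vl : v != last by rewrite site_eq // ltn_eqF.
  by case: ifP => _; [case: ifP => _|]; rewrite !inE vGG ?v0 ?vl.
subst v; have lF0 : last \in F0.
  by apply: contraTT vF => lF; rewrite /contract vF0 (negPf lF) !inE eqxx.
case: (boolP (first \in G0)) => fG0; last first.
  by case: (nocross first F0 G0 ncf).
case: (boolP (last \in G0)) => lG0; last by case: (nocross last F0 G0 ncl).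
by move: vG; rewrite /contract fG0 lG0 !inE fG0 first_neq_last.
Qed.

End OddAvoid.

(** * From an avoided vertex to a vertex star *)

Theorem gale_avoid (T : finType) (pos : T -> nat) (N d : nat) (site : nat -> T)
    (Y : pred {set T}) (F0 G0 : {set T}) :
    injective pos -> (forall k, k < N -> pos (site k) = k) -> 0 < d < N ->
    (forall F, Y F -> gale pos N d F) -> two_closed pos N d Y ->
    gale pos N d F0 -> ~~ Y F0 -> Y G0 -> near F0 G0 ->
    (forall G, Y G -> connect (near_in Y) G0 G) ->
  exists v F, [/\ gale pos N d F, v \in F & forall G, Y G -> v \notin G].
Proof.
move=> pos_inj siteK /andP[d0 dN] Yg Ycl gF0 nF0 YG0 nFG conn.
case: (boolP (odd d)) => od.
  have dE : d = d./2.*2.+1 by rewrite -[LHS]odd_double_half od.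
  case: N siteK dN Yg Ycl gF0 => // M siteK dM Yg Ycl gF0; rewrite dE in dM Yg Ycl gF0 *.
  have M0 : 0 < M by rewrite ltnS in dM; apply: leq_trans dM.
  exact: (odd_avoid pos_inj siteK M0 Yg Ycl gF0 nF0 YG0 nFG conn).
have dE : d = d./2.*2 by rewrite -[LHS]odd_double_half (negPf od).
rewrite dE in Yg Ycl gF0 *.
have [v /andP[vF _] vY] := even_avoid pos_inj siteK Yg Ycl gF0 nF0 YG0 nFG conn.
by exists v, F0.
Qed.

Section Complex.
Variables (T : finType) (pos : T -> nat) (N d : nat) (site : nat -> T).
Hypothesis pos_inj : injective pos.
Hypothesis siteK : forall k, k < N -> pos (site k) = k.
Hypothesis d_gt0 : 0 < d.
Hypothesis dN : d < N.
Variables K G : {set {set T}}.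
Hypothesis KE : forall s, (s \in K) = [exists F, gale pos N d F && (s \subset F)].
Hypothesis GK : subcomplex G K.
Hypothesis G_pure : pure_codim1 d G.
Hypothesis G_free : one_free_face G.
Implicit Types (F A B : {set T}).

Local Notation gale := (gale pos N d).

Lemma KP (s : {set T}) : reflect (exists2 F, gale F & s \subset F) (s \in K).
Proof.
rewrite KE; apply: (iffP existsP) => [[F /andP[gF sF]]|[F gF sF]]; exists F => //.
by rewrite gF.
Qed.

Lemma gale_card F : gale F -> #|F| = d.
Proof. by case/galeP. Qed.

Lemma gale_eq F B : gale F -> F \subset B -> B \in K -> B = F.
Proof.
move=> gF FB /KP[F' gF' BF']; apply/esym/eqP; rewrite eqEcard FB /=.
by rewrite (gale_card gF) -(gale_card gF') subset_leq_card.
Qed.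

Lemma gale_in F : gale F -> F \in K.
Proof. by move=> gF; apply/KP; exists F. Qed.

Lemma card_gale (s : {set T}) : s \in K -> #|s| = d -> gale s.
Proof.
case/KP=> F gF sF cs; suff -> : s = F by [].
by apply/eqP; rewrite eqEcard sF cs (gale_card gF) /=.
Qed.

Lemma maximal_K F : maximal_simplex K F <-> gale F.
Proof.
split=> [/maxsetP[/= FK Fmax]|gF].
  by have /KP[F' gF' FF'] := FK; rewrite -(Fmax F') //; apply: gale_in.
apply/maxsetP; split; first exact: gale_in.
by move=> B /= BK FB; apply: gale_eq.
Qed.

Let GsubK (s : {set T}) : s \in G -> s \in K.
Proof. by case: GK => /subsetP GsK _; apply: GsK. Qed.

Let G_down (s t : {set T}) : s \in G -> t \subset s -> t \in G.
Proof. by case: GK => _; apply. Qed.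

Lemma maximal_G F : maximal_simplex G F <-> (F \in G) && gale F.
Proof.
split=> [mF|/andP[FG gF]].
  have /maxsetP[/= FG _] := mF; rewrite FG /=.
  by apply: card_gale; [apply: GsubK | case: G_pure => _; apply].
apply/maxsetP; split=> // B /= BG FB; apply: gale_eq => //; exact: GsubK.
Qed.

Lemma G_facet (s : {set T}) : s \in G -> exists2 F, (F \in G) && gale F & s \subset F.
Proof.
move=> sG; have [F mF sF] := @maxset_exists T [pred t | t \in G] s sG.
by exists F => //; apply/maximal_G.
Qed.

(** The unique free face below F is a ridge: a face missing two vertices of F lies in F
    and in a ridge of F, hence has at least two larger faces. *)
Lemma free_ridge F : F \in G -> gale F ->
  exists u, [/\ u \in F, free_simplex G (F :\ u)
    & forall u', u' \in F -> free_simplex G (F :\ u') -> u' = u].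
Proof.
move=> FG gF; have mF : maximal_simplex G F by apply/maximal_G; rewrite FG.
have /eqP/cards1P[r rE] := G_free mF.
have : r \in [set r | free_simplex G r && (r \subset F)] by rewrite rE set11.
rewrite inE => /andP[fr rF]; have /andP[rG /cards1P[t tE]] := fr.
have up A : A \in G -> r \proper A -> A = t.
  by move=> AG rA; apply/eqP; rewrite -in_set1 -tE inE AG.
have tr : r \proper t by have := set11 t; rewrite -tE inE => /andP[].
have tG : t \in G by have := set11 t; rewrite -tE inE => /andP[].
have rpF : r \proper F.
  rewrite properE rF; apply: contraTN tr => Fr; rewrite properE negb_and negbK.
  have gr : gale r by rewrite (_ : r = F) //; apply/eqP; rewrite eqEsubset rF.
  case: (boolP (r \subset t)) => //= rt; rewrite (gale_eq gr rt) //; exact: GsubK.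
have /properP[_ [u uF ur]] := rpF; have FE : F = t by apply: up.
have rE' : F :\ u = r.
  apply/eqP; rewrite eqEsubset andbC subsetD1 rF ur /=.
  apply/subsetP=> y; rewrite !inE => /andP[yu yF]; apply: contraT => yr.
  have E : F :\ y = t.
    apply: up; first by apply: G_down FG (subD1set _ _).
    by apply/properP; split; [rewrite subsetD1 rF yr | exists u; rewrite // !inE uF eq_sym yu].
  by have : y \in F :\ y; [rewrite E -FE | rewrite !inE eqxx].
exists u; split=> //; first by rewrite rE'.
move=> u' u'F fu'; have : F :\ u' \in [set r | free_simplex G r && (r \subset F)].
  by rewrite inE fu' subD1set.
rewrite rE inE -rE' => /eqP E; apply/eqP; apply: contraT => uu'.
by have : u' \in F :\ u'; [rewrite E !inE uu' u'F | rewrite !inE eqxx].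
Qed.

Lemma nonfree_ridge F u : F \in G -> gale F -> u \in F -> ~~ free_simplex G (F :\ u) ->
  exists A, [/\ A \in G, gale A, A != F & F :\ u \subset A].
Proof.
move=> FG gF uF; rewrite /free_simplex (G_down FG (subD1set _ _)) /= => n1.
have FS : F \in [set t in G | F :\ u \proper t] by rewrite inE FG properD1.
move: n1; rewrite (cardsD1 F) FS /= eqSS cards_eq0 => /set0Pn[t].
rewrite !inE => /and3P[tF tG rt]; exists t; split=> //; last exact: proper_sub.
have [A /andP[AG gA] tA] := G_facet tG.
suff -> : t = A by [].
apply/eqP; rewrite eqEcard tA (gale_card gA) -(gale_card gF) (cardsD1 u F) uF.
exact: proper_card.
Qed.

Lemma ridge_facet (C A : {set T}) : #|C| = d.-1 -> gale A -> C \subset A ->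
  exists2 a, a \notin C & A = a |: C.
Proof.
move=> cC gA CA; have /properP[_ [a aA aC]] : C \proper A.
  by rewrite properEcard CA cC (gale_card gA) ltn_predL.
exists a => //; apply/esym/eqP; rewrite eqEcard subUset sub1set aA CA /=.
by rewrite cardsU1 aC cC (gale_card gA) add1n prednK.
Qed.

Lemma ridge_thin (C A B D : {set T}) : #|C| = d.-1 -> gale A -> gale B -> gale D ->
  C \subset A -> C \subset B -> C \subset D -> A != B -> A != D -> B != D -> False.
Proof.
move=> cC gA gB gD CA CB CD.
have [a aC EA] := ridge_facet cC gA CA; have [b bC EB] := ridge_facet cC gB CB.
have [e eC ED] := ridge_facet cC gD CD; rewrite EA EB ED in gA gB gD *.
move=> AB AD BD; have nE (x y : T) : x |: C != y |: C -> x != y by apply: contra_neq => ->.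
by apply: (gale_thin pos_inj aC bC eC _ _ _ gA gB gD); apply: nE.
Qed.

Definition outside F := gale F && (F \notin G).

Lemma card_ridge F u : gale F -> u \in F -> #|F :\ u| = d.-1.
Proof. by move=> gF uF; rewrite -(gale_card gF) (cardsD1 u F) uF. Qed.

Lemma near_ridge F A : gale F -> gale A -> F != A -> near F A ->
  exists u, [/\ u \in F, u \notin A & F :\ u \subset A].
Proof.
move=> gF gA FA nFA; have [u uF uA] : exists2 u, u \in F & u \notin A.
  apply/subsetPn; apply: contra FA => FA; rewrite eqEcard FA.
  by rewrite (gale_card gF) (gale_card gA) /=.
exists u; split=> //; apply/subsetP=> z; rewrite !inE => /andP[zu zF].
exact: near_mem nFA uF uA zF zu.
Qed.

Lemma outside_ridge F A u : F \in G -> gale F -> outside A -> u \in F ->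
  F :\ u \subset A -> free_simplex G (F :\ u).
Proof.
move=> FG gF /andP[gA nA] uF FA; apply: contraT => /(nonfree_ridge FG gF uF).
case=> B [BG gB BF FB].
case: (ridge_thin (card_ridge gF uF) gF gB gA (subD1set _ _) FB FA).
- by rewrite eq_sym.
- by apply: contraNneq nA => <-.
- by apply: contraNneq nA => <-.
Qed.

(** The ridges that F shares with the two outside facets are free, hence equal, and
    a ridge is in at most two facets. *)
Lemma outside_closed : two_closed pos N d outside.
Proof.
move=> F A B gF oA oB AB nFA nFB; rewrite /outside gF /=; apply/negP=> FG.
have [[gA nA] [gB nB]] := (andP oA, andP oB).
have FA : F != A by apply: contraNneq nA => <-.
have FB : F != B by apply: contraNneq nB => <-.
have [u [uF _ uA]] := near_ridge gF gA FA nFA.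
have [w [wF _ wB]] := near_ridge gF gB FB nFB.
have [f [_ _ fu]] := free_ridge FG gF.
have uf : u = f by apply: (fu _ uF); apply: (outside_ridge FG gF oA uF uA).
have wf : w = f by apply: (fu _ wF); apply: (outside_ridge FG gF oB wF wB).
have uw : u = w by rewrite uf wf.
rewrite -uw in wB.
exact: (ridge_thin (card_ridge gF uF) gF gA gB (subD1set _ _) uA wB FA FB AB).
Qed.

Lemma free_pivot F u : F \in G -> gale F -> u \in F -> free_simplex G (F :\ u) ->
  exists A, [/\ outside A, near F A, u \notin A & F :\ u \subset A].
Proof.
move=> FG gF uF /andP[_ /cards1P[t tE]].
have [w wF gA] := gale_pivot pos_inj siteK gF dN uF.
exists (w |: F :\ u); split; last exact: subsetUr.
- rewrite /outside gA; apply/negP=> AG.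
  have up B : B \in G -> F :\ u \proper B -> B = t.
    by move=> BG FB; apply/eqP; rewrite -in_set1 -tE inE BG.
  have E : w |: F :\ u = t.
    apply: up AG _; rewrite properE subsetUr subUset sub1set !inE.
    by rewrite (negPf wF) andbF.
  by move: wF; rewrite (up F FG (properD1 uF)) -E setU11.
- exact: near_swap'.
by rewrite !inE eqxx /= orbF; apply: contraNneq wF => <-.
Qed.

Hypothesis G_dual : dually_connected d G.
Hypothesis out_conn : forall A B, outside A -> outside B -> connect (near_in outside) A B.

Theorem complex_star : exists v, G = vertex_star K v.
Proof.
have [F0 F0G gF0] : exists2 F, F \in G & gale F.
  have [/set0Pn[s sG] _] := G_pure; have [F /andP[FG gF] _] := G_facet sG.
  by exists F.
have [u0 [u0F fu0 _]] := free_ridge F0G gF0.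
have [A0 [oA0 nFA _ _]] := free_pivot F0G gF0 u0F fu0.
have nF0 : ~~ outside F0 by rewrite /outside F0G andbF.
have og F : outside F -> gale F by case/andP.
have [v [F1 [gF1 vF1 vY]]] : exists v F, [/\ gale F, v \in F & forall A, outside A -> v \notin A].
  apply: (gale_avoid pos_inj siteK _ og outside_closed gF0 nF0 oA0 nFA).
    by rewrite d_gt0.
  by move=> A; apply: out_conn.
have starG F : gale F -> v \in F -> F \in G.
  by move=> gF; apply: contraTT => nF; apply: vY; rewrite /outside gF.
have F1G := starG _ gF1 vF1.
have step F B : v \in F -> dual_adj d G F B -> v \in B.
  move=> vF /and5P[FG BG /eqP cF /eqP cB /existsP[r /and3P[/eqP cr rF rB]]].
  have gF := card_gale (GsubK FG) cF; have gB := card_gale (GsubK BG) cB.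
  apply: contraT => vB; have [u [uF fu _]] := free_ridge FG gF.
  have [A [oA _ uA _]] := free_pivot FG gF uF fu.
  have uv : u = v.
    apply/eqP; apply: contraT => uv; have := vY _ oA.
    have [A' [oA' _ _ FA']] := free_pivot FG gF uF fu.
    have := vY _ oA'; rewrite (subsetP FA') // !inE vF eq_sym uv //.
  have rE : r = F :\ v.
    apply/eqP; rewrite eqEcard cr (card_ridge gF vF) leqnn andbT subsetD1 rF /=.
    by apply: contra vB => /(subsetP rB).
  rewrite uv -rE in fu; have /andP[_ /cards1P[t tE]] := fu.
  have up D : D \in G -> r \proper D -> D = t.
    by move=> DG rD; apply/eqP; rewrite -in_set1 -tE inE DG.
  have pr (D : {set T}) : r \subset D -> #|D| = d -> r \proper D.
    by move=> rD cD; rewrite properEcard rD cr cD ltn_predL.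
  by move: vB; rewrite (up B BG (pr _ rB cB)) -(up F FG (pr _ rF cF)) vF.
exists v; apply/setP=> s; rewrite inE; apply/idP/existsP=> [sG|[F /and3P[/maximal_K gF vF sF]]].
  have [F /andP[FG gF] sF] := G_facet sG; exists F; apply/and3P; split=> //.
    exact/maximal_K.
  have /connectP[p + ->] := G_dual F1G FG (gale_card gF1) (gale_card gF).
  elim: p (F1) vF1 => //= B p IHp D vD /andP[/(step _ _ vD) vB]; exact: IHp.
by apply: G_down sF; apply: starG.
Qed.

End Complex.

(** * The moment curve *)

From mathcomp Require Import all_order all_algebra.
From mathcomp Require Import all_classical all_reals all_analysis.
From mathcomp Require Import lra.
Import Order.TTheory GRing.Theory Num.Theory.
Import numFieldNormedType.Exports.

Local Open Scope classical_set_scope.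
Local Open Scope ring_scope.

Section Moment.
Variables (R : realType) (d n : nat) (t : 'I_n -> R).
Hypothesis d_ge2 : (2 <= d)%N.
Hypothesis dn : (d < n)%N.
Hypothesis t_inj : injective t.
Implicit Types (s F : {set 'I_n}) (p q : {poly R}).

Local Notation x := (cyclic_polytope_vertices d t).
Local Notation K := (boundary_complex x).
Local Notation P := (conv_hull x [set: 'I_n]%SET).

(** The affine functional that takes the value p.[u] at the point with parameter u of the
    moment curve. *)
Definition ev p (y : 'rV[R]_d) : R := p`_0 + \sum_(j < d) p`_j.+1 * y 0 j.

Lemma ev_vertex p i : (size p <= d.+1)%N -> ev p (x i) = p.[t i].
Proof.
move=> sp; rewrite (horner_coef_wide _ sp) big_ord_recl expr0 mulr1; congr (_ + _).
by apply: eq_bigr => j _; rewrite mxE.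
Qed.

Lemma ev_conv p s (a : 'I_n -> R) : (size p <= d.+1)%N -> \sum_(i in s) a i = 1 ->
  ev p (\sum_(i in s) a i *: x i) = \sum_(i in s) a i * p.[t i].
Proof.
move=> sp a1; under [RHS]eq_bigr do rewrite -(ev_vertex _ sp) /ev mulrDr.
rewrite big_split /= -mulr_suml a1 mul1r; congr (_ + _).
under [RHS]eq_bigr do rewrite mulr_sumr.
rewrite exchange_big /=; apply: eq_bigr => j _.
rewrite summxE mulr_sumr; apply: eq_bigr => i _.
by rewrite [in LHS]mxE mulrCA.
Qed.

Lemma ev_functional (c : 'cV[R]_d) (b : R) :
  exists2 p : {poly R}, (size p <= d.+1)%N & forall y, ev p y = b - (y *m c) 0 0.
Proof.
exists (\poly_(i < d.+1) (if i is j.+1 then - (c^T 0 (insubd (Ordinal (ltnW d_ge2)) j)) else b)).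
  exact: size_poly.
move=> y; rewrite /ev coef_poly /=; congr (_ + _).
rewrite mxE -sumrN; apply: eq_bigr => j _.
rewrite coef_poly ltnS ltn_ord mulNr mulrC mxE; congr (- (_ * c _ _)).
by apply: val_inj; rewrite val_insubd ltn_ord.
Qed.

Lemma ev_functionalV p : exists c : 'cV[R]_d, forall y, ev p y = p`_0 - (y *m c) 0 0.
Proof.
exists (\col_j - p`_j.+1) => y; rewrite /ev; congr (_ + _).
by rewrite mxE -sumrN; apply: eq_bigr => j _; rewrite mxE mulrN opprK mulrC.
Qed.

Lemma conv_vertex s i : i \in s -> conv_hull x s (x i).
Proof.
move=> is_; exists (fun j => (j == i)%:R); split.
- by move=> j; rewrite ler0n.
- by rewrite (bigD1 i) //= eqxx big1 ?addr0 // => j /andP[_ /negPf->].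
- by rewrite (bigD1 i) //= eqxx scale1r big1 ?addr0 // => j /andP[_ /negPf->]; rewrite scale0r.
Qed.

Lemma conv_restrict s s' (a : 'I_n -> R) : (forall i, 0 <= a i) ->
    \sum_(i in s) a i = 1 -> (forall i, i \in s -> i \notin s' -> a i = 0) ->
  conv_hull x (s :&: s')%SET (\sum_(i in s) a i *: x i).
Proof.
move=> a0 a1 az; exists a; split=> //.
  rewrite -a1 [RHS](big_setID s') /= [X in _ + X]big1 ?addr0 // => i.
  by rewrite inE => /andP[is' is_]; apply: az.
rewrite [LHS](big_setID s') /= [X in _ + X]big1 ?addr0 // => i.
by rewrite inE => /andP[is' is_]; rewrite az // scale0r.
Qed.

Lemma conv_sub s s' y : s \subset s' -> conv_hull x s y -> conv_hull x s' y.
Proof.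
move=> ss [a [a0 a1 ->]].
exists (fun i => if i \in s then a i else 0); split.
- by move=> i; case: ifP.
- rewrite -a1 [LHS](big_setID s) /= (finset.setIidPr ss) [X in _ + X]big1 ?addr0.
    by apply: eq_bigr => i ->.
  by move=> i; rewrite inE => /andP[/negPf->].
- rewrite [RHS](big_setID s) /= (finset.setIidPr ss) [X in _ + X]big1 ?addr0.
    by apply: eq_bigr => i ->.
  by move=> i; rewrite inE => /andP[/negPf->]; rewrite scale0r.
Qed.

(** The functional [ev p] is nonnegative on the polytope and vanishes exactly at the
    vertices in s. *)
Definition supports p s :=
  [/\ (size p <= d.+1)%N, forall i, 0 <= p.[t i] & forall i, (p.[t i] == 0) = (i \in s)].

Lemma ev_ge0 p s y : supports p s -> P y -> 0 <= ev p y.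
Proof.
case=> sp p0 _ [a [a0 a1 ->]]; rewrite ev_conv //.
by apply: sumr_ge0 => i _; apply: mulr_ge0.
Qed.

Lemma ev_eq0 p s s' (a : 'I_n -> R) : supports p s -> (forall i, 0 <= a i) ->
    \sum_(i in s') a i = 1 -> ev p (\sum_(i in s') a i *: x i) = 0 ->
  forall i, i \in s' -> i \notin s -> a i = 0.
Proof.
case=> sp p0 pz a0 a1; rewrite ev_conv // => /eqP.
rewrite psumr_eq0 => [/allP E i is' is_|i _]; last exact: mulr_ge0.
have := E i (mem_index_enum i); rewrite is' /= mulf_eq0 pz (negPf is_) orbF.
by move/eqP.
Qed.

Lemma ev_face p s y : supports p s -> P y -> ev p y = 0 -> conv_hull x s y.
Proof.
move=> sup [a [a0 a1 ->]] e0; have az := ev_eq0 sup a0 a1 e0.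
by have := conv_restrict a0 a1 az; rewrite finset.setTI.
Qed.

Lemma ev_on p s y : supports p s -> conv_hull x s y -> ev p y = 0.
Proof.
case=> sp _ pz [a [a0 a1 ->]]; rewrite ev_conv // big1 // => i is_.
by have := pz i; rewrite is_ => /eqP->; rewrite mulr0.
Qed.

(** This needs degree two; it shows that the points on the curve are vertices. *)
Lemma supports_vertex i : supports (('X - (t i)%:P) ^+ 2) [set i]%SET.
Proof.
split.
- rewrite size_exp_XsubC //.
- by move=> j; rewrite horner_exp sqr_ge0.
- by move=> j; rewrite horner_exp expf_eq0 hornerXsubC subr_eq0 inE (inj_eq t_inj).
Qed.

Lemma vertex_conv s i : conv_hull x s (x i) -> i \in s.
Proof.
case=> a [a0 a1 E]; apply: contraT => is_.
have sup := supports_vertex i.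
have e0 : ev (('X - (t i)%:P) ^+ 2) (x i) = 0.
  by apply: (ev_on sup); apply: conv_vertex; rewrite inE.
rewrite E in e0; have az := ev_eq0 sup a0 a1 e0.
move: a1; rewrite big1 => [/eqP|j js]; first by rewrite eq_sym oner_eq0.
by apply: az => //; rewrite inE; apply: contraNneq is_ => <-.
Qed.

(** A supporting hyperplane and a nonnegative polynomial are the same data. *)
Lemma boundary_supports s : (s \in K) <-> (exists p, supports p s) /\ s <> [set: 'I_n]%SET.
Proof.
rewrite inE; split=> [/asboolP[[c [b [cb FE]]] nP]|[[p sup] sT]].
  split; last by move=> sT; apply: nP; rewrite sT.
  have [p sp pE] := ev_functional c b; exists p; split=> // i.
    by rewrite -ev_vertex // pE subr_ge0; apply: cb; apply: conv_vertex; rewrite inE.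
  rewrite -ev_vertex // pE subr_eq0; apply/eqP/idP=> [E|is_].
    apply: vertex_conv; rewrite FE; split=> //.
    by apply: conv_vertex; rewrite inE.
  by have := conv_vertex is_; rewrite {1}FE => -[_ /= ->].
apply/asboolP; split; last first.
  move=> E; apply: sT; apply/setP=> i; rewrite !inE; apply: vertex_conv; rewrite E.
  by apply: conv_vertex; rewrite inE.
have [c cE] := ev_functionalV p; exists c, p`_0; split.
  by move=> y /(ev_ge0 sup); rewrite cE subr_ge0.
apply/seteqP; split=> y.
  move=> sy; split; first exact: conv_sub (finset.subsetT s) sy.
  by have := ev_on sup sy; rewrite cE => /eqP; rewrite subr_eq0 => /eqP /= ->.
case=> Py /= yE; apply: (ev_face sup) => //.
by rewrite cE yE subrr.
Qed.

End Moment.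

Section MomentFacets.
Variables (R : realType) (d n : nat) (t : 'I_n -> R).
Hypothesis d_ge2 : (2 <= d)%N.
Hypothesis dn : (d < n)%N.
Hypothesis t_inj : injective t.
Implicit Types (s F : {set 'I_n}) (p q : {poly R}) (i j : 'I_n).

Local Notation x := (cyclic_polytope_vertices d t).
Local Notation K := (boundary_complex x).
Local Notation supports := (supports d t).

(** Gale's condition refers to the order of the parameters, which may differ from the
    order of the indices. *)
Definition rank i := #|[set j | t j < t i]%SET|.

Lemma rank_lt i j : (rank i < rank j)%N = (t i < t j).
Proof.
apply/idP/idP=> [|ij].
  apply: contraTT; rewrite -leNgt -leqNgt => ji; apply: subset_leq_card.
  by apply/fintype.subsetP=> k; rewrite !inE => /lt_le_trans; apply.
apply: proper_card; apply/fintype.properP; split.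
  by apply/fintype.subsetP=> k; rewrite !inE => /lt_trans; apply.
by exists i; rewrite !inE ?ltxx.
Qed.

Lemma rank_inj : injective rank.
Proof.
move=> i j ij; apply: t_inj; apply/eqP; rewrite eq_le !leNgt -!rank_lt ij.
by rewrite ltnn.
Qed.

Lemma rank_ltn i : (rank i < n)%N.
Proof.
rewrite -[X in (_ < X)%N]card_ord -cardsT; apply: proper_card.
by apply/fintype.properP; split; [exact: finset.subsetT | exists i; rewrite !inE ?ltxx].
Qed.

Lemma rank_site : exists site : nat -> 'I_n, forall k, (k < n)%N -> rank (site k) = k.
Proof.
pose f i := Ordinal (rank_ltn i).
have f_inj : injective f by move=> i j /(congr1 val) /rank_inj.
pose i0 := Ordinal (leq_ltn_trans (leq0n d) dn).
exists (fun k => if [pick i | rank i == k] is Some i then i else i0) => k kn.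
case: pickP => [i /eqP //|none].
have := none (invF f_inj (Ordinal kn)).
by rewrite -[rank _]/(val (f _)) f_invF /= eqxx.
Qed.

Definition root_poly s : {poly R} := \prod_(i in s) ('X - (t i)%:P).

Lemma size_root_poly s : size (root_poly s) = #|s|.+1.
Proof. by rewrite /root_poly -big_enum size_prod_XsubC -cardE. Qed.

Lemma root_polyE s j : (root_poly s).[t j] = \prod_(i in s) (t j - t i).
Proof. by rewrite horner_prod; apply: eq_bigr => i _; rewrite hornerXsubC. Qed.

Lemma root_poly_eq0 s j : ((root_poly s).[t j] == 0) = (j \in s).
Proof.
rewrite root_polyE; apply/prodf_eq0/idP=> [[i is_]|js].
  by rewrite subr_eq0 (inj_eq t_inj) => /eqP->.
by exists j; rewrite ?subrr.
Qed.

(** Each parameter above that of j contributes a negative factor. *)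
Lemma root_poly_sign s j : j \notin s ->
  0 < (-1) ^+ (#|s| + below rank s j) * (root_poly s).[t j].
Proof.
move=> js; rewrite root_polyE exprD.
have -> : (-1) ^+ below rank s j = \prod_(i in s) (if t i < t j then -1 else 1) :> R.
  rewrite -big_mkcondr /= prodr_const; congr (_ ^+ _); apply: eq_card => i.
  by rewrite !inE rank_lt.
rewrite -prodr_const -!big_split /=; apply: prodr_gt0 => i is_.
have ij : t i != t j by rewrite (inj_eq t_inj); apply: contraNneq js => <-.
by case: (ltgtP (t i) (t j)) ij => // ij _; lra.
Qed.

Lemma supports_factor p s : supports p s -> exists q, p = q * root_poly s.
Proof.
case=> _ _ pz; have := @uniq_roots_prod_XsubC R p [seq t i | i <- enum s].
rewrite uniq_rootsE map_inj_uniq // enum_uniq big_map big_enum /=; apply=> //.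
apply/allP=> _ /mapP[i is_ ->]; rewrite /root pz.
by rewrite mem_enum in is_.
Qed.

Lemma supports_neq0 p s : supports p s -> s <> [set: 'I_n]%SET -> p != 0.
Proof.
case=> _ _ pz sT; apply: contra_notN sT => /eqP p0; apply/setP=> i.
by rewrite -pz p0 horner0 eqxx inE.
Qed.

Lemma supports_card p s : supports p s -> s <> [set: 'I_n]%SET -> (#|s| <= d)%N.
Proof.
move=> sup sT; have p0 := supports_neq0 sup sT; have [sp _ _] := sup.
have [q pq] := supports_factor sup; rewrite pq in p0 sp.
have q0 : q != 0 by apply: contraNneq p0 => ->; rewrite mul0r.
have r0 : root_poly s != 0 by rewrite -size_poly_eq0 size_root_poly.
rewrite size_mul // size_root_poly addnS /= in sp.
rewrite -ltnS; apply: leq_trans sp; rewrite -{1}[#|s|]add0n ltn_add2r.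
by rewrite lt0n size_poly_eq0.
Qed.

(** A polynomial of degree at most d with these d roots is a multiple of [root_poly s],
    so the sign of the latter is constant on the other parameters. *)
Lemma supports_gale p s : supports p s -> #|s| = d -> gale rank n d s.
Proof.
move=> sup cs; have sT : s <> [set: 'I_n]%SET.
  by move=> sT; move: dn; rewrite -cs sT cardsT card_ord ltnn.
have p0 := supports_neq0 sup sT; have [sp pge pz] := sup.
have [q pq] := supports_factor sup.
have q0 : q != 0 by apply: contraNneq p0 => q0; rewrite pq q0 mul0r.
have r0 : root_poly s != 0 by rewrite -size_poly_eq0 size_root_poly.
have [c c0 qc] : exists2 c : R, c != 0 & q = c%:P.
  apply/size_poly1P; rewrite eqn_leq lt0n size_poly_eq0 q0 andbT.
  by move: sp; rewrite pq size_mul // size_root_poly cs addnS /= -[in X in (_ <= X)%N]add1n leq_add2r.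
apply/and3P; split; first by rewrite cs.
  by apply/forall_inP=> i _; apply: rank_ltn.
apply/forallP=> i; apply/forallP=> j; apply/implyP=> /and4P[_ _ is_ js].
have sgn k : k \notin s -> 0 < (-1) ^+ (odd (d + below rank s k)) * c.
  move=> ks; have := root_poly_sign ks; rewrite cs.
  have pk : 0 < p.[t k] by rewrite lt_neqAle eq_sym pz ks pge.
  have r2 : 0 < (root_poly s).[t k] ^+ 2.
    by rewrite lt_neqAle sqr_ge0 eq_sym sqrf_eq0 root_poly_eq0 ks.
  move: pk; rewrite pq qc hornerM hornerC => pk rk.
  by rewrite -(pmulr_lgt0 _ r2) signr_odd expr2 mulrACA mulr_gt0.
have := sgn _ is_; have := sgn _ js; rewrite !oddD.
case: (odd d); case: (odd _); case: (odd _) => //=; rewrite ?expr0 ?expr1 ?mulN1r ?mul1r ?oppr_gt0 => h1 h2;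
  by have := lt_trans h1 h2; rewrite ltxx.
Qed.

Lemma gale_supports s : gale rank n d s -> exists p, supports p s.
Proof.
case/galeP=> cs _ [b par]; exists ((-1) ^+ (d + b) *: root_poly s).
have pos j : j \notin s -> 0 < ((-1) ^+ (d + b) *: root_poly s).[t j].
  move=> js; have := root_poly_sign js; rewrite hornerZ cs.
  rewrite (_ : (-1) ^+ (d + below rank s j) = (-1) ^+ (d + b)) //.
  by rewrite -[LHS]signr_odd -[RHS]signr_odd !oddD (par _ (rank_ltn j) js) oddb.
have zero j : (((-1) ^+ (d + b) *: root_poly s).[t j] == 0) = (j \in s).
  by rewrite hornerZ mulf_eq0 signr_eq0 root_poly_eq0.
split=> // [|j].
  by rewrite (leq_trans (size_scale_leq _ _)) // size_root_poly cs.
case: (boolP (j \in s)) => [|/pos/ltW//].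
by rewrite -zero => /eqP->.
Qed.

Lemma supportsI p q s s' : supports p s -> supports q s' ->
  supports (p + q) (s :&: s')%SET.
Proof.
move=> [sp p0 pz] [sq q0 qz]; split.
- by rewrite (leq_trans (size_polyD _ _)) // geq_max sp.
- by move=> i; rewrite hornerD addr_ge0.
- by move=> i; rewrite hornerD paddr_eq0 // pz qz finset.inE.
Qed.

(** Adding two supporting polynomials intersects their zero sets, and every subset of
    a facet is obtained by intersecting with pivots of this facet. *)
Lemma gale_sub_supports F s : gale rank n d F -> s \subset F -> exists p, supports p s.
Proof.
move=> gF; have [site siteK] := rank_site.
have [k] := ubnP #|F :\: s|%SET; elim: k s => // k IHk s Fk sF.
case: (set_0Vmem (F :\: s)%SET) => [F0|[u]].
  suff -> : s = F by apply: gale_supports.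
  apply/eqP; rewrite finset.eqEsubset sF; apply/fintype.subsetP=> z zF.
  apply: contraT => zs; have : z \in (F :\: s)%SET by rewrite finset.inE zs.
  by rewrite F0 finset.inE.
rewrite inE => /andP[us uF]; have [||p sup] := IHk (u |: s)%SET.
- move: Fk; rewrite (cardsD1 u) !finset.inE us uF add1n ltnS.
  apply: leq_ltn_trans; apply: subset_leq_card; apply/fintype.subsetP=> z.
  by rewrite !finset.inE negb_or => /andP[/andP[-> ->] ->].
- by rewrite finset.subUset finset.sub1set uF.
have [w wF gA] := gale_pivot rank_inj siteK gF dn uF.
have [q supq] := gale_supports gA; exists (p + q).
suff -> : s = ((u |: s) :&: (w |: F :\ u))%SET by apply: supportsI.
apply/setP=> z; rewrite !finset.inE; case: (eqVneq z u) => [->|zu] /=.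
  by rewrite (negPf us) orbF; apply/esym/negbTE; apply: contraNneq wF => <-.
case: (boolP (z \in s)) => //= zs.
by rewrite (fintype.subsetP sF) ?orbT.
Qed.

(** Subtracting from p a multiple of a polynomial q that vanishes on s and at one more
    vertex j0 keeps p positive at j0.  The multiple is chosen so that a further value
    reaches zero while the others stay nonnegative. *)
Lemma supports_grow p s : supports p s -> (#|s| < d)%N ->
  exists p' s', [/\ supports p' s', s \proper s' & s' <> [set: 'I_n]%SET].
Proof.
move=> [sp p0 pz] sd.
have out (s' : {set 'I_n}) : (#|s'| < n)%N -> exists j, j \notin s'.
  move=> cs'; apply/existsP; apply: contraTT cs'; rewrite negb_exists => /forallP all.
  rewrite -leqNgt -[X in (X <= _)%N]card_ord -cardsT subset_leq_card //.
  by apply/fintype.subsetP=> z _; have := all z; rewrite negbK.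
have [j0 js] : exists j, j \notin s by apply: out; apply: ltn_trans sd _.
have [k0 ks] : exists k, k \notin (j0 |: s)%SET.
  by apply: out; rewrite cardsU1 js; apply: leq_ltn_trans dn.
pose q := root_poly (j0 |: s)%SET.
have qz j : (q.[t j] == 0) = (j \in j0 |: s)%SET by apply: root_poly_eq0.
have sq : (size q <= d.+1)%N by rewrite size_root_poly cardsU1 js.
(* the first parameter where the difference can vanish minimizes this ratio *)
pose f j := p.[t j] / `|q.[t j]|.
have [k knot kmin] := @arg_minP _ _ _ k0 (fun j => j \notin (j0 |: s)%SET) f ks.
pose l := p.[t k] / q.[t k].
have nq j : j \notin (j0 |: s)%SET -> 0 < `|q.[t j]|.
  by move=> js'; rewrite normr_gt0 qz.
have fin j : j \notin (j0 |: s)%SET -> l * q.[t j] <= p.[t j].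
  move=> js'; have := kmin j js'; rewrite /f ler_pdivlMr ?nq // => le_f.
  apply: le_trans le_f; apply: le_trans (ler_norm _) _.
  by rewrite normrM /l normrM normfV (ger0_norm (p0 k)).
pose p' := p - l *: q.
have sp' : (size p' <= d.+1)%N.
  by rewrite (leq_trans (size_polyD _ _)) // geq_max sp size_polyN (leq_trans (size_scale_leq _ _)).
have p'E j : p'.[t j] = p.[t j] - l * q.[t j] by rewrite hornerD hornerN hornerZ.
have qs j : j \in (j0 |: s)%SET -> p'.[t j] = p.[t j].
  by rewrite -qz p'E => /eqP->; rewrite mulr0 subr0.
have supp : supports p' [set j | p'.[t j] == 0]%SET.
  split=> // [j|j]; last by rewrite finset.inE.
  case: (boolP (j \in (j0 |: s)%SET)) => [/qs->//|/fin].
  by rewrite p'E subr_ge0.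
exists p', [set j | p'.[t j] == 0]%SET; split=> //.
  apply/fintype.properP; split.
    apply/fintype.subsetP=> j js'; rewrite finset.inE qs ?pz //.
    by rewrite finset.inE js' orbT.
  exists k; last by move: knot; rewrite finset.inE negb_or => /andP[].
  by rewrite finset.inE p'E /l divfK ?subrr // qz.
move/setP/(_ j0); rewrite !finset.inE qs ?finset.setU11 // pz.
by rewrite (negPf js).
Qed.

Lemma supports_gale_sub p s : supports p s -> s <> [set: 'I_n]%SET ->
  exists2 F, gale rank n d F & s \subset F.
Proof.
have [k] := ubnP (d - #|s|); elim: k p s => // k IHk p s sk sup sT.
have := supports_card sup sT; rewrite leq_eqVlt => /orP[/eqP cs|sd].
  by exists s => //; apply: supports_gale sup cs.
have [p' [s' [sup' ss' sT']]] := supports_grow sup sd.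
have [|F gF s'F] := IHk _ _ _ sup' sT'.
  rewrite -ltnS; apply: leq_trans sk; rewrite ltnS; apply: ltn_sub2l => //.
  exact: proper_card.
by exists F => //; apply: fintype.subset_trans (proper_sub ss') s'F.
Qed.

(** The boundary complex is pure, and its facets are the Gale sets. *)
Lemma boundary_gale s : (s \in K) = [exists F, gale rank n d F && (s \subset F)].
Proof.
apply/idP/existsP=> [/(boundary_supports d_ge2 t_inj)[[p sup] sT]|[F /andP[gF sF]]].
  by have [F gF sF] := supports_gale_sub sup sT; exists F; rewrite gF.
apply/(boundary_supports d_ge2 t_inj); split; first exact: gale_sub_supports gF sF.
move=> sT; have /galeP[cF _ _] := gF; have := subset_leq_card sF.
by rewrite sT cF cardsT card_ord leqNgt dn.
Qed.

End MomentFacets.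

(** * Connectedness of the complementary facets *)

Section Separation.
Variables (R : realType) (d n : nat) (t : 'I_n -> R).
Hypothesis d_ge2 : (2 <= d)%N.
Hypothesis dn : (d < n)%N.
Hypothesis t_inj : injective t.
Variable G : {set {set 'I_n}}.

Local Notation x := (cyclic_polytope_vertices d t).
Local Notation K := (boundary_complex x).
Local Notation gale := (gale (rank t) n d).
Local Notation outside := (outside (rank t) n d G).

Hypothesis GK : subcomplex G K.
Hypothesis G_nonsep : non_separating x G.

Lemma ev_continuous (p : {poly R}) : continuous (ev (d := d) p).
Proof.
have cS : continuous (fun z : 'rV[R]_d => \sum_(j < d) p`_j.+1 * z 0 j).
  apply: continuous_big => [|j _ z]; first exact: add_continuous.
  exact: (cvgM (cvg_cst _) (@coord_continuous R 1 d 0 j z)).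
by move=> y; apply: (cvgD (cvg_cst p`_0) (cS y)).
Qed.

Lemma hyperplane_closed (p : {poly R}) : closed [set y | ev (d := d) p y = 0].
Proof.
have /continuous_closedP : continuous (ev (d := d) p) by exact: ev_continuous.
by move=> cl; apply: (cl [set z | z = 0]); apply: closed_eq.
Qed.

Lemma supporting : exists q : {set 'I_n} -> {poly R}, forall F, gale F -> supports d t (q F) F.
Proof.
have /choice[q qP] : forall F, exists p, gale F -> supports d t p F.
  move=> F; case: (boolP (gale F)) => [gF|_]; last by exists 0.
  by have [p sup] := gale_supports t_inj gF; exists p.
by exists q.
Qed.

Definition barycenter (F : {set 'I_n}) : 'rV[R]_d := \sum_(i in F) d%:R^-1 *: x i.

Lemma barycenter_sum F : gale F -> \sum_(i in F) d%:R^-1 = 1 :> R.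
Proof.
case/galeP=> cF _ _; rewrite sumr_const cF -[LHS]mulr_natr mulVf //.
by rewrite pnatr_eq0 -lt0n ltnW.
Qed.

Lemma barycenter_conv F : gale F -> conv_hull x F (barycenter F).
Proof.
move=> gF; exists (fun=> d%:R^-1); split=> //; exact: barycenter_sum.
Qed.

(** A face containing a relatively interior point of F contains F. *)
Lemma barycenter_out F : outside F ->
  (realization x K `\` realization x G) (barycenter F).
Proof.
move=> /andP[gF nF]; split.
  exists F; last exact: barycenter_conv.
  by rewrite /= boundary_gale //; apply/existsP; exists F; rewrite gF /=.
case=> s /= sG sb; move/negP: nF; apply.
have [/fintype.subsetP GsK down] := GK.
apply: (down _ _ sG); apply/fintype.subsetP=> i iF; apply: contraT => is_.
have /(boundary_supports d_ge2 t_inj)[[p sup] _] := GsK _ sG.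
have e0 := ev_on sup sb.
have a0 (j : 'I_n) : 0 <= d%:R^-1 :> R by rewrite invr_ge0 ler0n.
have /eqP := ev_eq0 sup a0 (barycenter_sum gF) e0 iF is_.
by rewrite invr_eq0 pnatr_eq0 eqn0Ngt ltnW.
Qed.

(** Within the complement U of G, lying on the facets of one class is a closed condition,
    since on U it amounts to lying on one of finitely many hyperplanes.  A point of U
    on F1 and F2 lies in the face F1 :&: F2, which is then not in G; all the facets
    through this face are outside and connected to each other. *)
Theorem outside_connected A B : outside A -> outside B -> connect (near_in outside) A B.
Proof.
move=> oA oB; apply: contraT => nAB.
have [q qP] := supporting.
have [/fintype.subsetP GsK down] := GK.
pose side1 F := outside F && connect (near_in outside) A F.
pose side2 F := outside F && ~~ connect (near_in outside) A F.
pose C (side : pred {set 'I_n}) := \bigcup_(F in [set F | side F]) [set y | ev (d := d) (q F) y = 0].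
have closedC side : closed (C side).
  apply: closed_bigcup => [|F _]; last exact: hyperplane_closed.
  exact: finite_finset.
set U := realization x K `\` realization x G.
have UP y : U y -> conv_hull x [set: 'I_n]%SET y.
  by case=> -[s _ sy] _; apply: conv_sub sy; apply: finset.subsetT.
have cover y : U y -> exists2 F, outside F & ev (q F) y = 0.
  case=> -[s /= sK sy] nG.
  move: sK; rewrite boundary_gale // => /existsP[F /andP[gF sF]].
  have Fy := conv_sub sF sy; exists F; last exact: ev_on (qP F gF) Fy.
  by rewrite /outside gF; apply/negP=> FG; apply: nG; exists F.
have disj y : U y -> C side1 y -> C side2 y -> False.
  move=> Uy [F1 /= /andP[out1 c1] e1] [F2 /= /andP[out2 c2] e2].
  have [[g1 n1] [g2 n2]] := (andP out1, andP out2).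
  have [a [a0 a1 yE]] : conv_hull x F1 y := ev_face (qP _ g1) (UP y Uy) e1.
  rewrite yE in e2; have az := ev_eq0 (qP _ g2) a0 a1 e2.
  have y12 := conv_restrict d t a0 a1 az; rewrite -yE in y12.
  have n12 : (F1 :&: F2)%SET \notin G.
    by apply/negP=> sG; case: Uy => _; apply; exists (F1 :&: F2)%SET.
  apply: (negP c2); apply: (connect_trans c1).
  have sub : subrel (link_near (rank t) n d (F1 :&: F2)%SET) (connect (near_in outside)).
    move=> A1 A2 /and5P[gA1 gA2 sA1 sA2 nA]; apply: connect1.
    apply/and3P; split=> //; apply/andP; split=> //; apply: contra n12 => AG.
      exact: down AG sA1.
    exact: down AG sA2.
  have L := link_connected (rank_inj t_inj) g1 g2
    (finset.subsetIl F1 F2) (finset.subsetIr F1 F2).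
  exact: connect_sub sub _ _ L.
have UA := barycenter_out oA; have UB := barycenter_out oB.
have onC (side : pred {set 'I_n}) F : side F -> gale F -> C side (barycenter F).
  by move=> sF gF; exists F => //=; apply: ev_on (qP F gF) (barycenter_conv gF).
have [gA _] := andP oA; have [gB _] := andP oB.
have CA : C side1 (barycenter A) by apply: onC => //; rewrite /side1 oA connect0.
have CB : C side2 (barycenter B) by apply: onC => //; rewrite /side2 oB.
have UE : U `&` C side1 = U.
  apply: (G_nonsep (B := U `&` C side1)).
  - by exists (barycenter A).
  - exists (~` C side2); first by rewrite openC.
    apply/seteqP; split=> y [Uy Cy]; split=> //; first by move=> C2; apply: (disj y).
    have [F oF eF] := cover y Uy; case: (boolP (connect (near_in outside) A F)) => cF.
      by exists F; rewrite //= /side1 oF.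
    by case: Cy; exists F; rewrite //= /side2 oF.
  - by exists (C side1).
have : (U `&` C side1) (barycenter B) by rewrite UE.
by case=> _ C1; case: (disj _ UB C1 CB).
Qed.

End Separation.

Theorem theorem6 (R : realType) (d n : nat) (t : 'I_n -> R) :
  (2 <= d)%N -> (d < n)%N -> injective t ->
  satisfies_perles (cyclic_polytope_vertices d t).
Proof.
move=> d2 dn t_inj G GK G_pure G_dual G_nonsep G_free.
have [site siteK] := rank_site dn t_inj.
apply: (complex_star (rank_inj t_inj) siteK (ltnW d2) dn _ GK G_pure G_free G_dual).
  by move=> s; apply: boundary_gale.
by move=> A B; apply: outside_connected.
Qed.
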